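(* Let $t>0$. For every packing $\mathscr{C}$ of $\mathbb{R}^3$ by capped $t$-cylinders, the upper density satisfies $$\rho^+(\mathscr{C}) \le \frac{\pi}{\sqrt{12}} + \frac{10}{t}.$$
   Context: A $t$-cylinder is a closed solid circular cylinder in $\mathbb{R}^3$ of unit radius and length $t$. A capped $t$-cylinder is a $t$-cylinder together with solid unit hemispherical caps on its two ends; equivalently, it is the set of points of $\mathbb{R}^3$ at distance at most $1$ from a line segment of length $t$ (its axis). A packing of $\mathbb{R}^3$ by capped $t$-cylinders is a countable family $\mathscr{C}=\{C_i\}_{i\in I}$ of capped $t$-cylinders in $\mathbb{R}^3$ with mutually disjoint interiors. $B(R)$ is the closed ball of radius $R$ centered at $0$. The upper density is $$\rho^+(\mathscr{C})=\limsup_{R\to\infty}\ \sum_{i\in I:\, C_i\subseteq B(R)}\frac{\mathrm{Vol}(C_i)}{\mathrm{Vol}(B(R))}.$$ *)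

(* Defs.v *)
From HB Require Import structures.
From mathcomp Require Import all_boot all_order all_algebra.
From mathcomp Require Import all_classical all_reals all_analysis.

Set Implicit Arguments.
Unset Strict Implicit.
Unset Printing Implicit Defensive.

Import Order.TTheory GRing.Theory Num.Theory.
Import numFieldNormedType.Exports.

Local Open Scope classical_set_scope.
Local Open Scope ring_scope.

(* Three-dimensional space is R * R * R with its product topology, the usual
   one.  The library norm `|p| on a product is the sup norm, hence the separate
   Euclidean norm. *)
Definition enorm (R : realType) (p : R * R * R) : R :=
  Num.sqrt (p.1.1 ^+ 2 + p.1.2 ^+ 2 + p.2 ^+ 2).

Definition edist_to (R : realType) (A : set (R * R * R)) (p : R * R * R) : R :=
  inf [set enorm (p - q) | q in A].

Definition eball (R : realType) (r : R) : set (R * R * R) :=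
  [set p | enorm p <= r].

Definition segment (R : realType) (a b : R * R * R) : set (R * R * R) :=
  [set a + s *: (b - a) | s in `[0, 1]].

Definition capped_cylinder (R : realType) (t : R) (C : set (R * R * R)) : Prop :=
  exists a b : R * R * R,
    enorm (b - a) = t /\ C = [set p | edist_to (segment a b) p <= 1].

(* Countable families may be finite or empty: [I] is any [countType]. *)
Definition packing (R : realType) (t : R) (I : countType)
    (C : I -> set (R * R * R)) : Prop :=
  (forall i, capped_cylinder t (C i)) /\
  trivIset [set: I] (fun i => interior (C i)).

Definition volume (R : realType) (A : set (R * R * R)) : \bar R :=
  (((@lebesgue_measure R \x @lebesgue_measure R) \x @lebesgue_measure R) A)%E.

(* The limit superior is over the real radius r tending to +oo; values at
   r <= 0, where the ball has volume 0, play no role. *)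
Definition upper_density (R : realType) (I : countType)
    (C : I -> set (R * R * R)) : \bar R :=
  limf_esup
    (fun r : R => \esum_(i in [set i | C i `<=` eball r])
                    (volume (C i) / volume (eball r))%E)
    (pinfty_nbhs R).

(* Main.v *)
Require Import Defs.
From HB Require Import structures.
From mathcomp Require Import all_boot all_order all_algebra.
From mathcomp Require Import all_classical all_reals all_analysis.
From mathcomp Require Import measurable_realfun ring lra.

Set Implicit Arguments.
Unset Strict Implicit.
Unset Printing Implicit Defensive.

Import Order.TTheory GRing.Theory Num.Theory.
Import numFieldNormedType.Exports.

Local Open Scope classical_set_scope.
Local Open Scope ring_scope.

(** An upper bound for the volume of a capped cylinder is divided by a lower bound
    for the volume of a cell, a set attached to each cylinder such that the cells
    are disjoint.  Here rho denotes circ_rad = 2 / sqrt 3.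

    For t <= 40 the unit tube around the axis will do as a cell: a capped cylinder
    has volume at most pi (t + 2), and (t + 2) / t is below the bound
    (small_density).

    For t >= 40 the axis is thickened to a tube of radius rho, which is then cut
    short by 2 rho at both ends; points in several such cores are left to the nearer
    axis (cell).  Disjoint interiors put any two axes at distance at least 2
    (disjoint_interior_far), so that a core may lose volume to a neighbour, in the
    shape of one half of the lens common to two tubes.  Two facts bound the loss.
    First, half of a lens has volume at most lens_ratio times the volume of the
    region of the tube that faces the neighbour (half_lens_le).  Secondly, regions
    facing different neighbours are disjoint, because no point is closer than rho to
    three points at mutual distances at least 2 (dist2_three, touches_unique).  Hence
    a core loses at most lens_ratio times the volume pi rho^2 t of the whole tube, and
    the choice of lens_ratio makes (1 - lens_ratio) pi rho^2 equal to sqrt 12.  So a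
    cell has volume at least sqrt 12 t - 4 pi rho^3 (cell_volume, cell_boundE), against
    about pi t for the capped cylinder, which gives the leading term pi / sqrt 12.

    The inequality for half of a lens reduces to the plane.  The planes perpendicular
    to the bisector of two lines cut the tubes around them in congruent ellipses with
    parallel axes.  One affine map turns both ellipses into discs of radius rho, and
    the distance of their centres is at least 2 (slice_centre_far).  In the plane, a
    segment cut off by a chord at distance at least 1 from the centre has area at most
    lens_ratio times that of its sector, because sin is concave on [0, pi / 3]
    (area_segment_le_sector).  In coordinates in which one of the lines is the third
    axis, the affine map and the passage to slices are one volume-preserving shear
    (frame_half_lens_le).

    Volumes are computed in such coordinates, since rotations preserve Lebesgue
    measure, being products of shears (mp_rot2). *)

(** * Lebesgue measure in the plane and in space *)

(** A constant of its own, so that inference finds the sigma-finite structure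
    declared below. *)
Definition leb2 {R : realType} :
    set (measurableTypeR R * measurableTypeR R)%type -> \bar R :=
  (@lebesgue_measure R \x @lebesgue_measure R)%E.

HB.instance Definition _ (R : realType) := Measure.on (@leb2 R).

Lemma leb2_sigma_finite (R : realType) : sigma_finite setT (@leb2 R).
Proof.
have /sigma_finiteP[F [TF ndF Foo]] := sigma_finiteT (@lebesgue_measure R).
exists (fun n => F n `*` F n).
  rewrite -setXTT TF predeqE => -[x y]; split.
    move=> [/= [n _ Fnx] [k _ Gky]]; exists (maxn n k) => //; split.
    - by move: x Fnx; exact/subsetPset/ndF/leq_maxl.
    - by move: y Gky; exact/subsetPset/ndF/leq_maxr.
  by move=> [n _ []/= ? ?]; split; exists n.
move=> k; have [? ?] := Foo k.
split; first exact: measurableX.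
by rewrite /leb2 product_measure1E// lte_mul_pinfty// ge0_fin_numE.
Qed.

HB.instance Definition _ (R : realType) :=
  Measure_isSigmaFinite.Build _ _ _ (@leb2 R) (@leb2_sigma_finite R).

Definition leb3 {R : realType} :
    set (measurableTypeR R * measurableTypeR R * measurableTypeR R)%type -> \bar R :=
  (@leb2 R \x @lebesgue_measure R)%E.

HB.instance Definition _ (R : realType) := Measure.on (@leb3 R).

Lemma volumeE (R : realType) (A : set (R * R * R)) : volume A = leb3 A.
Proof. by []. Qed.

(** * Shears and rotations preserve the measure *)

Definition measure_preserving {d} {T : measurableType d} {R : realType}
    (m : set T -> \bar R) (g : T -> T) : Prop :=
  measurable_fun setT g /\ forall A, measurable A -> m (g @^-1` A) = m A.

Lemma measure_preserving_comp {d} {T : measurableType d} {R : realType}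
    (m : set T -> \bar R) (f g : T -> T) :
  measure_preserving m f -> measure_preserving m g -> measure_preserving m (f \o g).
Proof.
move=> [mf hf] [mg hg]; split; first exact: measurableT_comp.
move=> A mA; rewrite comp_preimage hg ?hf//.
by rewrite -[X in measurable X]setTI; apply: mf.
Qed.

Section line.
Context {R : realType}.
Local Notation mu := (@lebesgue_measure R).
Lemma lebesgue_shift (c : R) (A : set R) : measurable A ->
  mu ((fun x => x + c) @^-1` A) = mu A.
Proof.
move=> mA.
have mf : measurable_fun [set: measurableTypeR R] (fun x : measurableTypeR R => x + c : measurableTypeR R).
  exact: measurable_funD.
apply/esym.
have := @lebesgue_measure_unique R (measure_function_pushforward__canonical__measure_function_Measure mu mf).
apply => //.
move=> X /= [[a b] _ <-].
rewrite /pushforward lebesgue_measure_itv/=.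
rewrite (_ : _ @^-1` _ = [set` `]a-c,b-c]]); last first.
  by apply/seteqP; split => x /=; rewrite !in_itv/= ltrBlDr lerBrDr.
rewrite lebesgue_measure_itv/= !lte_fin ltrD2r.
by case: ifP => // _; rewrite -!EFinB; congr (_%:E); ring.
Qed.
End line.

Section products.
Context {R : realType} {d1 d2 : measure_display}
  {T1 : measurableType d1} {T2 : measurableType d2}.
Variables (m1 : {sigma_finite_measure set T1 -> \bar R})
  (m2 : {sigma_finite_measure set T2 -> \bar R}).

Lemma product_measure_ysection (A : set (T1 * T2)) : measurable A ->
  (m1 \x m2)%E A = (\int[m2]_y m1 (ysection A y))%E.
Proof.
move=> mA; transitivity ((m1 \x^ m2)%E A); last by [].
apply: product_measure_unique => // B C mB mC; exact: product_measure2E.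
Qed.

Lemma mp_snd_fiber (g : T1 -> T2 -> T2) :
  measurable_fun setT (fun p : T1 * T2 => g p.1 p.2) ->
  (forall x, measure_preserving m2 (g x)) ->
  measure_preserving (m1 \x m2)%E (fun p => (p.1, g p.1 p.2)).
Proof.
move=> mg hg.
have mG : measurable_fun setT (fun p : T1 * T2 => (p.1, g p.1 p.2)).
  exact: measurable_fun_pair.
split => // A mA.
apply: eq_integral => x _ /=.
rewrite -((hg x).2 (xsection A x)); last exact: measurable_xsection.
by congr (m2 _); apply/seteqP; split => y /=; rewrite /xsection/= !inE.
Qed.

Lemma mp_fst_fiber (g : T2 -> T1 -> T1) :
  measurable_fun setT (fun p : T1 * T2 => g p.2 p.1) ->
  (forall x, measure_preserving m1 (g x)) ->
  measure_preserving (m1 \x m2)%E (fun p => (g p.2 p.1, p.2)).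
Proof.
move=> mg hg.
have mG : measurable_fun setT (fun p : T1 * T2 => (g p.2 p.1, p.2)).
  exact: measurable_fun_pair.
split => // A mA.
rewrite !product_measure_ysection//; last first.
  by rewrite -[X in measurable X]setTI; exact: mG.
apply: eq_integral => y _ /=.
rewrite -((hg y).2 (ysection A y)); last exact: measurable_ysection.
by congr (m1 _); apply/seteqP; split => x /=; rewrite /ysection/= !inE.
Qed.

Lemma mp_fst (g : T1 -> T1) : measure_preserving m1 g ->
  measure_preserving (m1 \x m2)%E (fun p => (g p.1, p.2)).
Proof.
move=> mg; apply: (mp_fst_fiber (g := fun=> g)) => //.
by apply: measurableT_comp => //; exact: mg.1.
Qed.

End products.

Section shears.
Context {R : realType}.
Local Notation RR := (measurableTypeR R).
Local Notation mu := (@lebesgue_measure R).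

Lemma mp_translation (c : R) : measure_preserving mu (fun x : RR => x + c : RR).
Proof.
split; first exact: measurable_funD.
by move=> A mA; exact: lebesgue_shift.
Qed.

Lemma mp_shear_snd {d} {T : measurableType d}
    (m : {sigma_finite_measure set T -> \bar R}) (f : T -> RR) :
  measurable_fun setT f ->
  measure_preserving (m \x mu)%E (fun p : T * RR => (p.1, p.2 + f p.1 : RR)).
Proof.
move=> mf; have := @mp_snd_fiber R _ _ T _ m mu (fun x y => y + f x : RR); apply => [|x].
  by apply: measurable_funD => //; exact: measurableT_comp.
exact: mp_translation.
Qed.

Lemma mp_shear_fst {d} {T : measurableType d}
    (m : {sigma_finite_measure set T -> \bar R}) (f : T -> RR) :
  measurable_fun setT f ->
  measure_preserving (mu \x m)%E (fun p : RR * T => (p.1 + f p.2 : RR, p.2)).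
Proof.
move=> mf; have := @mp_fst_fiber R _ _ _ T mu m (fun x y => y + f x : RR); apply => [|x].
  by apply: measurable_funD => //; exact: measurableT_comp.
exact: mp_translation.
Qed.

Definition rot2 (c s : R) (p : RR * RR) : RR * RR :=
  (c * p.1 - s * p.2, s * p.1 + c * p.2).

(** A plane rotation is the product of three shears: first coordinate, second,
    first again. *)
Lemma mp_rot2_aux (c s : R) : c ^+ 2 + s ^+ 2 = 1 -> 1 + c != 0 ->
  measure_preserving (@leb2 R) (rot2 c s).
Proof.
move=> cs c1.
(* k is the tangent of half the angle of the rotation. *)
pose k := s / (1 + c).
have ml (a : R) : measurable_fun setT (fun x : RR => a * x : RR).
  exact: mulrl_measurable.
have S1 : measure_preserving (@leb2 R) (fun p : RR * RR => (p.1 + - k * p.2 : RR, p.2)).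
  exact: (@mp_shear_fst _ _ mu _ (ml (- k))).
have S2 : measure_preserving (@leb2 R) (fun p : RR * RR => (p.1, p.2 + s * p.1 : RR)).
  exact: (@mp_shear_snd _ _ mu _ (ml s)).
have := measure_preserving_comp S1 (measure_preserving_comp S2 S1).
rewrite (_ : _ \o _ = rot2 c s)//; apply/funext => -[x y] /=.
rewrite /rot2/=.
have s2 : s ^+ 2 = (1 - c) * (1 + c) by transitivity (1 - c ^+ 2); [rewrite -cs; ring | ring].
have ks : k * s = 1 - c by rewrite /k mulrAC -expr2 s2 mulfK.
have kc : k * (1 + c) = s by rewrite /k divfK.
congr (_, _).
- transitivity (x - k * y - k * y - (k * s) * x + (k * s) * (k * y)); first by ring.
  by rewrite ks -kc; ring.
- transitivity (y + s * x - (k * s) * y); first by ring.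
  by rewrite ks; ring.
Qed.

Lemma mp_rot2 (c s : R) : c ^+ 2 + s ^+ 2 = 1 ->
  measure_preserving (@leb2 R) (rot2 c s).
Proof.
move=> cs; have [c1|c1] := eqVneq (1 + c) 0; last exact: mp_rot2_aux.
have cE : c = -1 by apply/eqP; rewrite -addr_eq0 addrC c1.
have sE : s = 0.
  by apply/eqP; rewrite -sqrf_eq0; apply/eqP; move: cs; rewrite cE => cs; lra.
(* The half turn is the square of a quarter turn. *)
have H : measure_preserving (@leb2 R) (rot2 0 1).
  by apply: mp_rot2_aux; [ring | rewrite addr0 oner_eq0].
have := measure_preserving_comp H H; rewrite (_ : _ \o _ = rot2 c s)//.
by apply/funext => -[x y] /=; rewrite /rot2/= cE sE; congr (_, _); ring.
Qed.

(** The first coordinate is made the outermost variable of integration, which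
    lets a map of the last two coordinates act inside the integral. *)
Lemma leb3_first (A : set (RR * RR * RR)) : measurable A ->
  leb3 A = (\int[mu]_x leb2 [set q : RR * RR | A (x, q.1, q.2)])%E.
Proof.
move=> mA.
have mF : measurable_fun setT (fun p : RR * RR => mu (xsection A p)).
  exact: measurable_fun_xsection.
rewrite {1}/leb3 {1}/product_measure1 /=.
rewrite /leb2 (@fubini_tonelli1 _ _ _ _ _ mu mu (fun p => mu (xsection A p)))//.
Qed.

Lemma mp_rot2_fst (c s : R) : c ^+ 2 + s ^+ 2 = 1 ->
  measure_preserving (@leb3 R) (fun p : RR * RR * RR => (rot2 c s p.1, p.2)).
Proof. by move=> cs; apply: mp_fst; apply: mp_rot2. Qed.

Lemma mp_lift_yz (g : RR * RR -> RR * RR) : measure_preserving (@leb2 R) g ->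
  measure_preserving (@leb3 R) (fun p : RR * RR * RR =>
     (p.1.1, (g (p.1.2, p.2)).1, (g (p.1.2, p.2)).2)).
Proof.
move=> [mg hg].
have mG : measurable_fun setT (fun p : RR * RR * RR =>
     (p.1.1, (g (p.1.2, p.2)).1, (g (p.1.2, p.2)).2)).
  have mh : measurable_fun setT (fun p : RR * RR * RR => g (p.1.2, p.2)).
    apply: measurableT_comp => //; apply: measurable_fun_pair => //.
    exact: measurableT_comp.
  apply: measurable_fun_pair; last exact: measurableT_comp.
  apply: measurable_fun_pair; last exact: measurableT_comp.
  exact: measurableT_comp.
split; first exact: mG.
move=> A mA.
have mA' : measurable ((fun p : RR * RR * RR =>
     (p.1.1, (g (p.1.2, p.2)).1, (g (p.1.2, p.2)).2)) @^-1` A).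
  by rewrite -[X in measurable X]setTI; apply: mG.
rewrite (leb3_first mA) (leb3_first mA').
apply: eq_integral => x _.
have mAx : measurable [set q : RR * RR | A (x, q.1, q.2)].
  have mk : measurable_fun setT (fun q : RR * RR => (x, q.1, q.2)).
    by apply: measurable_fun_pair => //; apply: measurable_fun_pair.
  by rewrite -[X in measurable X]setTI; exact: mk.
rewrite -(hg _ mAx); congr (leb2 _).
by apply/funext => -[y z].
Qed.
End shears.

(** * Integration of a circular arc *)

Section calculus.
Context {R : realType}.
Local Notation mu := (@lebesgue_measure R).

Lemma integral_derive (F f : R -> R) (a b : R) : a <= b ->
  (forall x : R, is_derive x (1 : R) F (f x)) -> continuous f ->
  (\int[mu]_(x in `[a, b]) (f x)%:E = (F b - F a)%:E)%E.
Proof.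
rewrite le_eqVlt => /predU1P[<-|ab] dF cf.
  by rewrite set_itv1 integral_set1 subrr.
have cF : continuous F.
  by move=> x; apply/differentiable_continuous/derivable1_diffP; apply: ex_derive.
rewrite (@continuous_FTC2 _ f F)//.
- exact: continuous_subspaceT.
- split; last by apply: cvg_at_left_filter; exact: cF.
    by move=> x _; apply: ex_derive.
  by apply: cvg_at_right_filter; exact: cF.
- by move=> x _; rewrite derive1E; apply: derive_val.
Qed.

(** The substitution x = r sin y turns the integrand into a smooth one, also for
    b = pi / 2, where the original has no derivative at the end points. *)
Lemma integral_sqrt_arc (r k h b : R) : 0 <= r -> 0 <= b <= pi / 2 ->
  (\int[mu]_(x in `[(- (r * sin b))%R, (r * sin b)%R])
     (k * Num.sqrt (r ^+ 2 - x ^+ 2) - h)%R%:E =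
   (k * r ^+ 2 * (b + sin b * cos b) - 2 * h * r * sin b)%:E)%E.
Proof.
rewrite le_eqVlt => /predU1P[<-|r0] /andP[b0 bpi].
  rewrite !mul0r oppr0 set_itv1 integral_set1; congr (_%:E); ring.
have Nb : - (r * sin b) = r * sin (- b) by rewrite sinN mulrN.
pose F := fun x : R => r * sin x.
have dF (x : R) : is_derive x (1 : R) F (r * cos x).
  by rewrite (_ : F = GRing.scale_fun r (sin : R -> R))//; apply: is_derive_eq.
have F'E : derive1 F = (fun x => r * cos x).
  by apply/funext => x; rewrite derive1E; apply: derive_val.
have cF : continuous F.
  by move=> x; apply/differentiable_continuous/derivable1_diffP; apply: ex_derive.
have cF' : continuous (fun x : R => r * cos x).
  by move=> x; apply: cvgM; [exact: cvg_cst | exact: continuous_cos].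
have cG : continuous (fun x : R => k * Num.sqrt (r ^+ 2 - x ^+ 2) - h).
  move=> x; apply: cvgB; last exact: cvg_cst.
  apply: cvgM; first exact: cvg_cst.
  apply: (@continuous_comp _ _ _ (fun x : R => r ^+ 2 - x ^+ 2) Num.sqrt).
    by apply: cvgB; [exact: cvg_cst | exact: exprn_continuous].
  exact: sqrt_continuous.
have cosge x : x \in `[- b, b] -> 0 <= cos x.
  rewrite in_itv/= => /andP[bx xb]; apply: cos_ge0_pihalf.
  by rewrite (le_trans _ bx) ?lerN2// (le_trans xb).
rewrite Nb -/(F b) -/(F (- b)).
rewrite (@integration_by_substitution_increasing R F)//.
- transitivity (\int[mu]_(x in `[(- b)%R, b])
      (k * r ^+ 2 * cos x ^+ 2 - h * r * cos x)%R%:E)%E.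
    apply: eq_integral => x; rewrite inE => xb; congr (_%:E).
    rewrite F'E /= mulrfctE/= /F (_ : r ^+ 2 - _ = (r * cos x) ^+ 2); last first.
      by rewrite !exprMn cos2sin2; ring.
    by rewrite sqrtr_sqr ger0_norm; [ring | rewrite mulr_ge0 ?(ltW r0)// cosge].
  pose A := fun x : R => k * r ^+ 2 / 2 * (x + sin x * cos x) - h * r * sin x.
  have dA (x : R) : is_derive x (1 : R) A (k * r ^+ 2 * cos x ^+ 2 - h * r * cos x).
    have dsc := is_deriveD (is_derive_id x (1 : R)) (is_deriveM (is_derive_sin x) (is_derive_cos x)).
    have dAx := is_deriveB (is_deriveZ (k * r ^+ 2 / 2) dsc) (is_deriveZ (h * r) (is_derive_sin x)).
    apply: (is_derive_eq dAx).
    have s2 : sin x ^+ 2 = 1 - cos x ^+ 2 by rewrite sin2cos2.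
    rewrite /GRing.scale/=; transitivity (k * r ^+ 2 / 2 * (1 - sin x ^+ 2 + cos x ^+ 2) - h * r * cos x); first by ring.
    by rewrite s2; field.
  rewrite (integral_derive _ dA); first by rewrite /A sinN cosN; congr (_%:E); field.
    lra.
  move=> x; apply: cvgB; apply: cvgM; try exact: cvg_cst; last exact: continuous_cos.
  apply: (@continuous_comp _ _ _ cos (fun y : R => y ^+ 2)); first exact: continuous_cos.
  exact: exprn_continuous.
- lra.
- move=> x y xb yb xy; rewrite /F ltr_pM2l// ltr_sin//; rewrite in_itv/=.
    by move: xb; rewrite in_itv/= => /andP[? ?]; apply/andP; split; lra.
  by move: yb; rewrite in_itv/= => /andP[? ?]; apply/andP; split; lra.
- by rewrite F'E => x _; exact: cF'.
- by rewrite F'E; apply/cvg_ex; exists (r * cos (- b)); apply: cvg_at_right_filter; exact: cF'.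
- by rewrite F'E; apply/cvg_ex; exists (r * cos b); apply: cvg_at_left_filter; exact: cF'.
- split.
  + by move=> x _; apply: ex_derive.
  + by apply: cvg_at_right_filter; exact: cF.
  + by apply: cvg_at_left_filter; exact: cF.
- exact: continuous_subspaceT.
Qed.
End calculus.

(** * The number pi and a chord of the sine *)

Section trig.
Context {R : realType}.
Local Notation q := (Num.sqrt (3 : R)).

Lemma sqrt3_gt0 : 0 < q. Proof. by rewrite sqrtr_gt0. Qed.
Lemma sqrt3_sqr : q ^+ 2 = 3. Proof. by rewrite sqr_sqrtr. Qed.

Lemma pi6_gt0 : 0 < pi / 6 :> R. Proof. by rewrite divr_gt0 ?pi_gt0. Qed.

Lemma cos_pi6 : cos (pi / 6) = q / 2 :> R.
Proof.
have c0 : 0 < cos (pi / 6 : R).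
  by apply: cos_gt0_pihalf; have := pi_gt0 R; move=> ?; apply/andP; split; lra.
(* cos (3 x) = cos x (4 cos^2 x - 3) vanishes at x = pi / 6. *)
have : cos (pi / 6 + (pi / 6) *+ 2 : R) = 0.
  by rewrite (_ : _ + _ = pi / 2) ?cos_pihalf//; field.
rewrite cosD cos_mulr2n sin_mulr2n => H.
have : cos (pi / 6 : R) * (4 * cos (pi / 6) ^+ 2 - 3) = 0.
  rewrite -[RHS]H; have s2 := sin2cos2 (pi / 6 : R).
  transitivity (cos (pi / 6 : R) * (cos (pi / 6 : R) ^+ 2 *+ 2 - 1) - sin (pi/6 : R) ^+ 2 * cos (pi/6 : R) *+ 2).
    by rewrite s2; ring.
  by ring.
move/eqP; rewrite mulf_eq0 gt_eqF//= => /eqP c2.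
have : (cos (pi / 6)) ^+ 2 = (q / 2) ^+ 2.
  by rewrite expr_div_n sqrt3_sqr; lra.
by move/eqP; rewrite eqrXn2 ?divr_ge0 ?sqrtr_ge0 ?(ltW c0)// => /eqP.
Qed.

Lemma sin_pi6 : sin (pi / 6) = 1 / 2 :> R.
Proof.
have s0 : 0 < sin (pi / 6 : R).
  by apply: sin_gt0_pihalf; have := pi_gt0 R; move=> ?; apply/andP; split; lra.
have : sin (pi / 6) ^+ 2 = (1 / 2) ^+ 2 :> R.
  by rewrite sin2cos2 cos_pi6 !expr_div_n sqrt3_sqr; lra.
by move/eqP; rewrite eqrXn2 ?divr_ge0 ?(ltW s0)// => /eqP.
Qed.

(** From sin x <= x at x = pi / 6. *)
Lemma pi_ge3 : 3 <= pi :> R.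
Proof.
have [c _] : exists2 c, c \in `]0, pi / 6[%R & sin (pi / 6) - sin 0 = cos c * (pi / 6 - 0) :> R.
  apply: (@MVT R sin cos) => //; first exact: pi6_gt0.
  by apply: continuous_subspaceT; exact: continuous_sin.
rewrite sin0 sin_pi6 !subr0 => H.
have c1 := cos_le1 c; have := pi6_gt0; nra.
Qed.

(** From x cos x <= sin x at x = pi / 6. *)
Lemma pi_le_sqrt12 : pi <= 2 * q.
Proof.
pose F := fun x : R => sin x - x * cos x.
have dF (x : R) : is_derive x (1 : R) F (x * sin x).
  have := is_deriveB (is_derive_sin x)
    (is_deriveM (is_derive_id x (1 : R)) (is_derive_cos x)).
  move=> H; apply: (is_derive_eq H); rewrite /GRing.scale/=; ring.
have [c] : exists2 c, c \in `]0, pi / 6[%R & F (pi / 6) - F 0 = c * sin c * (pi / 6 - 0) :> R.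
  apply: (@MVT R F (fun x => x * sin x)) => //; first exact: pi6_gt0.
  apply: continuous_subspaceT => x.
  by apply/differentiable_continuous/derivable1_diffP; apply: ex_derive.
rewrite in_itv/= => /andP[c0 cpi].
have s0 : 0 < sin c by apply: sin_gt0_pihalf; have := pi_gt0 R; move=> ?; apply/andP; split; lra.
rewrite /F sin0 sin_pi6 cos_pi6 mul0r !subr0 => H.
have : 0 < c * sin c * (pi / 6) by rewrite !mulr_gt0// pi_gt0.
rewrite -H => {}H.
have q0 := sqrt3_gt0; have q2 := sqrt3_sqr.
rewrite -(ler_pM2r q0); nra.
Qed.

(** The right side is sin (2 b) / 2, the left side its chord over [0, pi / 6].  If
    the chord were above the graph at b, the derivative of the difference would be
    negative somewhere before b and positive somewhere after it, whereas cos
    decreases. *)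
Lemma sin_cos_ge_chord (b : R) : 0 <= b <= pi / 6 ->
  3 * q / (2 * pi) * b <= sin b * cos b.
Proof.
move=> /andP[b0 b6]; rewrite leNgt; apply/negP => Hlt.
have p0 := pi_gt0 R.
have b_gt0 : 0 < b.
  by rewrite lt_neqAle b0 andbT; apply/eqP => bE; move: Hlt; rewrite -bE sin0 !mul0r mulr0 ltxx.
pose m : R := 3 * q / (2 * pi).
have mpi : m * (pi / 6) = q / 4.
  have : pi != 0 :> R by rewrite gt_eqF.
  by rewrite /m; move: (pi : R) => p p0'; field.
have b_lt : b < pi / 6.
  rewrite lt_neqAle b6 andbT; apply/eqP => bE; move: Hlt.
  by rewrite bE -/m mpi sin_pi6 cos_pi6; lra.
pose F := fun x : R => sin x * cos x - m * x.
have dF (x : R) : is_derive x (1 : R) F (2 * cos x ^+ 2 - 1 - m).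
  have := is_deriveB (is_deriveM (is_derive_sin x) (is_derive_cos x))
    (is_deriveZ m (is_derive_id x (1 : R))).
  move=> H; apply: (is_derive_eq H); rewrite /GRing.scale/=.
  have := sin2cos2 x => s2; transitivity (cos x ^+ 2 - sin x ^+ 2 - m); first by ring.
  by rewrite s2; ring.
have cF : continuous F.
  by move=> x; apply/differentiable_continuous/derivable1_diffP; apply: ex_derive.
have [c1 c1b e1] : exists2 c, c \in `]0, b[%R & F b - F 0 = (2 * cos c ^+ 2 - 1 - m) * (b - 0) :> R.
  by apply: (@MVT R F (fun x => 2 * cos x ^+ 2 - 1 - m)) => //; exact: continuous_subspaceT.
have [c2 c2b e2] : exists2 c, c \in `]b, pi / 6[%R & F (pi / 6) - F b = (2 * cos c ^+ 2 - 1 - m) * (pi / 6 - b) :> R.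
  by apply: (@MVT R F (fun x => 2 * cos x ^+ 2 - 1 - m)) => //; exact: continuous_subspaceT.
have F0 : F 0 = 0 by rewrite /F sin0; ring.
have F6 : F (pi / 6) = 0 by rewrite /F mpi sin_pi6 cos_pi6; lra.
have Fb : F b < 0 by rewrite /F subr_lt0.
move: c1b c2b; rewrite !in_itv/= => /andP[c10 c1b] /andP[c2b c26].
have cos12 : cos c2 < cos c1 by rewrite ltr_cos ?in_itv/=; [lra|apply/andP; split; lra|apply/andP; split; lra].
have cos2 : 0 < cos c2 by apply: cos_gt0_pihalf; apply/andP; split; lra.
rewrite F0 !subr0 in e1; rewrite F6 sub0r in e2.
have h1 : 2 * cos c1 ^+ 2 - 1 - m < 0.
  by rewrite -(pmulr_llt0 _ b_gt0) -e1.
have h2 : 0 < 2 * cos c2 ^+ 2 - 1 - m.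
  have d0 : 0 < pi / 6 - b by rewrite subr_gt0.
  by rewrite -(pmulr_lgt0 _ d0) -e2 oppr_gt0.
nra.
Qed.
End trig.

(** * Measurability of sets given by inequalities *)

Section measurability.
Context {R : realType} {d : measure_display} {T : measurableType d}.
Lemma measurable_set_le (f g : T -> R) : measurable_fun setT f ->
  measurable_fun setT g -> measurable [set x | f x <= g x].
Proof.
move=> mf mg; have := measurable_fun_ler mf mg.
move=> /(_ measurableT [set true]); rewrite setTI; exact.
Qed.

Lemma measurable_set_lt (f g : T -> R) : measurable_fun setT f ->
  measurable_fun setT g -> measurable [set x | f x < g x].
Proof.
move=> mf mg; have := measurable_fun_ltr mf mg.
move=> /(_ measurableT [set true]); rewrite setTI; exact.
Qed.

Lemma measurable_set_and (A B : T -> Prop) : measurable [set x | A x] ->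
  measurable [set x | B x] -> measurable [set x | A x /\ B x].
Proof. exact: measurableI. Qed.

Lemma measurable_fun_sqrtr (f : T -> R) : measurable_fun setT f ->
  measurable_fun setT (fun x => Num.sqrt (f x)).
Proof.
move=> mf; apply: (@measurableT_comp _ _ _ _ _ _ (Num.sqrt : R -> R)) => //.
by apply: continuous_measurable_fun; exact: sqrt_continuous.
Qed.

Lemma measurable_fun_invr (f : T -> R) : (forall x, 0 <= f x) ->
  measurable_fun setT f -> measurable_fun setT (fun x => (f x)^-1).
Proof.
move=> f0 mf; under eq_fun do rewrite -powR_inv1//.
apply: (@measurableT_comp _ _ _ _ _ _ (fun x : R => x `^ (-1))) => //.
Qed.
End measurability.

(** The cases follow the syntax of a polynomial expression in the coordinates. *)
Ltac mfun := lazymatch goal with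
  | |- measurable_fun _ (fun x => GRing.add (@?f x) (@?g x)) =>
      apply: (@measurable_funD _ _ _ _ f g); mfun
  | |- measurable_fun _ (fun x => GRing.mul (@?f x) (@?g x)) =>
      apply: (@measurable_funM _ _ _ _ f g); mfun
  | |- measurable_fun _ (fun x => GRing.opp (@?f x)) =>
      apply: (@measurable_funN _ _ _ _ f); mfun
  | |- measurable_fun _ (fun x => GRing.exp (@?f x) ?n) =>
      apply: (@measurable_funX _ _ _ _ f n); mfun
  | |- measurable_fun _ (fun x => Num.sqrt (@?f x)) =>
      apply: (@measurable_fun_sqrtr _ _ _ f); mfun
  | |- measurable_fun _ (fun x => x) => exact: measurable_id
  | |- measurable_fun _ fst => exact: measurable_fst
  | |- measurable_fun _ snd => exact: measurable_snd
  | |- measurable_fun _ (fun x => x.1) => exact: measurable_fst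
  | |- measurable_fun _ (fun x => x.2) => exact: measurable_snd
  | |- measurable_fun _ (fun x => x.1.1) => apply: measurableT_comp; exact: measurable_fst
  | |- measurable_fun _ (fun x => x.1.2) =>
      apply: measurableT_comp; [exact: measurable_snd|exact: measurable_fst]
  | |- _ => exact: measurable_cst
  end.
Ltac mset := repeat (apply: measurable_set_and);
  first [apply: measurable_set_le | apply: measurable_set_lt]; mfun.

(** * Areas of discs, circular segments and triangles *)

Section planar.
Context {R : realType}.
Local Notation RR := (measurableTypeR R).
Local Notation mu := (@lebesgue_measure R).
Local Notation q := (Num.sqrt (3 : R)).

Lemma leb2_xsections (A : set (RR * RR)) (a b : R) (f : R -> R) :
  (forall x, mu (xsection A x) = if x \in `[a, b] then (f x)%:E else 0%E) ->
  leb2 A = (\int[mu]_(x in `[a, b]) (f x)%:E)%E.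
Proof.
move=> H; rewrite /leb2 /product_measure1 [RHS]integral_mkcond; apply: eq_integral => x _ /=.
by rewrite H patchE mem_setE; case: ifPn.
Qed.

Lemma leb2_ysections (A : set (RR * RR)) (a b : R) (f : R -> R) : measurable A ->
  (forall x, mu (ysection A x) = if x \in `[a, b] then (f x)%:E else 0%E) ->
  leb2 A = (\int[mu]_(x in `[a, b]) (f x)%:E)%E.
Proof.
move=> mA H; rewrite /leb2 product_measure_ysection// [RHS]integral_mkcond.
apply: eq_integral => x _ /=.
by rewrite H patchE mem_setE; case: ifPn.
Qed.

Lemma ler_sqr_sqrt (y a : R) : 0 <= a -> (y ^+ 2 <= a) = (- Num.sqrt a <= y <= Num.sqrt a).
Proof. by move=> a0; rewrite -ler_norml -sqrtr_sqr ler_sqrt. Qed.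

Lemma ltr_sqr_sqrt (y a : R) : 0 < a -> (y ^+ 2 < a) = (- Num.sqrt a < y < Num.sqrt a).
Proof. by move=> a0; rewrite -ltr_norml -sqrtr_sqr ltr_sqrt. Qed.

Lemma area_closed_disk (r : R) : 0 <= r ->
  leb2 [set p : RR * RR | p.1 ^+ 2 + p.2 ^+ 2 <= r ^+ 2] = (pi * r ^+ 2)%:E.
Proof.
move=> r0.
have p0 := pi_gt0 R.
rewrite (@leb2_xsections _ (- (r * sin (pi / 2))) (r * sin (pi / 2))
  (fun x => 2 * Num.sqrt (r ^+ 2 - x ^+ 2) - 0)).
  rewrite integral_sqrt_arc ?cos_pihalf//; first by congr (_%:E); field.
  by apply/andP; split; lra.
move=> x; rewrite sin_pihalf mulr1 in_itv/= subr0.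
case: ifPn => [/andP[rx xr]|xr].
  have a0 : 0 <= r ^+ 2 - x ^+ 2 by nra.
  rewrite (_ : xsection _ _ =
      ([set` `[- Num.sqrt (r ^+ 2 - x ^+ 2), Num.sqrt (r ^+ 2 - x ^+ 2)]] : set R)); last first.
    apply/seteqP; split => y; rewrite /xsection/= !in_setE/= in_itv/= -ler_sqr_sqrt// => ?; lra.
  have s0 := sqrtr_ge0 (r ^+ 2 - x ^+ 2).
  rewrite lebesgue_measure_itv/= lte_fin; case: ifPn => [_|]; first by rewrite -EFinB; congr (_%:E); ring.
  by rewrite -leNgt => ?; congr (_%:E); lra.
rewrite (_ : xsection _ _ = set0) ?measure0//.
rewrite -subset0 => y; rewrite /xsection/= !in_setE/= => H.
by move/negP: xr; apply; apply/andP; split; nra.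
Qed.

Lemma area_open_disk (r : R) : 0 <= r ->
  leb2 [set p : RR * RR | p.1 ^+ 2 + p.2 ^+ 2 < r ^+ 2] = (pi * r ^+ 2)%:E.
Proof.
move=> r0.
have p0 := pi_gt0 R.
rewrite (@leb2_xsections _ (- (r * sin (pi / 2))) (r * sin (pi / 2))
  (fun x => 2 * Num.sqrt (r ^+ 2 - x ^+ 2) - 0)).
  rewrite integral_sqrt_arc ?cos_pihalf//; first by congr (_%:E); field.
  by apply/andP; split; lra.
move=> x; rewrite sin_pihalf mulr1 in_itv/= subr0.
have [a0|a0] := ltP 0 (r ^+ 2 - x ^+ 2).
  rewrite ifT; last by apply/andP; split; nra.
  rewrite (_ : xsection _ _ =
      ([set` `]- Num.sqrt (r ^+ 2 - x ^+ 2), Num.sqrt (r ^+ 2 - x ^+ 2)[] : set R)); last first.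
    apply/seteqP; split => y; rewrite /xsection/= !in_setE/= in_itv/= -ltr_sqr_sqrt// => ?; lra.
  have s0 : 0 < Num.sqrt (r ^+ 2 - x ^+ 2) by rewrite sqrtr_gt0.
  rewrite lebesgue_measure_itv/= lte_fin ifT; last lra.
  by rewrite -EFinB; congr (_%:E); ring.
rewrite (_ : xsection _ _ = set0) ?measure0.
  by case: ifP => // _; rewrite ler0_sqrtr// mulr0.
rewrite -subset0 => y; rewrite /xsection/= !in_setE/= => H.
have := sqr_ge0 y; lra.
Qed.

(** The chord itself has measure 0, so any set between the segments without and
    with the chord has the same area; b is half of the opening angle. *)
Lemma area_segment (r b : R) (A : set (RR * RR)) : 0 <= r -> 0 <= b <= pi / 2 ->
  [set p : RR * RR | p.1 ^+ 2 + p.2 ^+ 2 <= r ^+ 2 /\ r * cos b < p.2] `<=` A ->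
  A `<=` [set p : RR * RR | p.1 ^+ 2 + p.2 ^+ 2 <= r ^+ 2 /\ r * cos b <= p.2] ->
  leb2 A = (r ^+ 2 * (b - sin b * cos b))%:E.
Proof.
move=> r0 /andP[b0 bpi] Al Au.
have p0 := pi_gt0 R.
have c0 : 0 <= cos b by apply: cos_ge0_pihalf; apply/andP; split; lra.
have s0 : 0 <= sin b by apply: sin_ge0_pi; apply/andP; split; lra.
have cs : (r * cos b) ^+ 2 + (r * sin b) ^+ 2 = r ^+ 2.
  by rewrite !exprMn sin2cos2; ring.
have rc0 : 0 <= r * cos b by rewrite mulr_ge0.
have rs0 : 0 <= r * sin b by rewrite mulr_ge0.
rewrite (@leb2_xsections _ (- (r * sin b)) (r * sin b)
  (fun x => 1 * Num.sqrt (r ^+ 2 - x ^+ 2) - r * cos b)).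
  rewrite integral_sqrt_arc ?b0//; congr (_%:E); ring.
move=> x; rewrite in_itv/= mul1r.
case: ifPn => [/andP[rx xr]|xr]; last first.
  rewrite (_ : xsection _ _ = set0) ?measure0//.
  rewrite -subset0 => y; rewrite /xsection/= !in_setE/= => /Au/= [H1 H2].
  by move/negP: xr; apply; apply/andP; split; nra.
have a0 : 0 <= r ^+ 2 - x ^+ 2 by nra.
have rcs : r * cos b <= Num.sqrt (r ^+ 2 - x ^+ 2).
  by rewrite -(ger0_norm rc0) -sqrtr_sqr ler_sqrt//; nra.
set s := Num.sqrt _ in rcs *.
have [e|lt_rcs] := eqVneq (r * cos b) s.
  have : mu (xsection A x) = 0%E; last by move=> ->; rewrite e subrr.
  have : xsection A x `<=` [set s].
    move=> y; rewrite /xsection/= !in_setE/= => /Au/= [H1 H2].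
    apply/eqP; rewrite eq_le -{2}e H2 andbT.
    by have /andP[] : - s <= y <= s by rewrite -ler_sqr_sqrt//; lra.
  by move/subset_set1 => [->|->]; rewrite ?measure0 ?lebesgue_measure_set1.
have ltrs : r * cos b < s by rewrite lt_neqAle lt_rcs.
have [inA|ninA] := pselect (A (x, r * cos b)).
  rewrite (_ : xsection _ _ = ([set` `[r * cos b, s]] : set R)); last first.
    apply/seteqP; split => y; rewrite /xsection/= !in_setE/= in_itv/=.
      move=> /Au/= [H1 ->]/=.
      by have /andP[] : - s <= y <= s by rewrite -ler_sqr_sqrt//; lra.
    move=> /andP[ry0 ys]; have [->//|yne] := eqVneq y (r * cos b).
    have ry : r * cos b < y by rewrite lt_neqAle eq_sym yne.
    by apply: Al => /=; split => //; rewrite addrC -lerBrDr ler_sqr_sqrt// -/s ys andbT; lra.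
  by rewrite lebesgue_measure_itv/= lte_fin ltrs -EFinB.
rewrite (_ : xsection _ _ = ([set` `]r * cos b, s]] : set R)); last first.
  apply/seteqP; split => y; rewrite /xsection/= !in_setE/= in_itv/=.
    move=> Ay; have /=[H1 H2] := Au _ Ay.
    have -> : r * cos b < y.
      by rewrite lt_neqAle H2 andbT; apply/eqP => yE; case: ninA; rewrite yE.
    by have /andP[] : - s <= y <= s by rewrite -ler_sqr_sqrt//; lra.
  move=> /andP[ry ys].
  by apply: Al => /=; split => //; rewrite addrC -lerBrDr ler_sqr_sqrt// -/s ys andbT; lra.
by rewrite lebesgue_measure_itv/= lte_fin ltrs -EFinB.
Qed.

Lemma area_triangle (h w : R) : 0 < h -> 0 <= w ->
  leb2 [set p : RR * RR | (p.2 <= h /\ 0 < p.2) /\ (h * p.1 < w * p.2 /\ - (w * p.2) < h * p.1)]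
  = (w * h)%:E.
Proof.
move=> h0 w0.
rewrite (@leb2_ysections _ 0 h (fun y => 2 * w / h * y)).
- have dF (x : R) : is_derive x (1 : R) (fun x : R => w / h * x ^+ 2) (2 * w / h * x).
    have H := is_deriveZ (w / h) (is_deriveX 2 (is_derive_id x (1 : R))).
    by apply: (is_derive_eq H); rewrite /GRing.scale/= expr1; ring.
  rewrite (integral_derive _ dF) ?(ltW h0)//; first by congr (_%:E); field; exact: lt0r_neq0.
  by move=> x; apply: cvgM; [exact: cvg_cst|exact: cvg_id].
- mset.
move=> y; rewrite in_itv/=.
case: ifPn => [/andP[y0 yh]|yh]; last first.
  rewrite (_ : ysection _ _ = set0) ?measure0//.
  rewrite -subset0 => x; rewrite /ysection/= !in_setE/= => -[[H1 H2] _].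
  by move/negP: yh; apply; apply/andP; split => //; exact: ltW.
move: y0; rewrite le_eqVlt => /predU1P[<-|y0].
  rewrite (_ : ysection _ _ = set0) ?measure0 ?mulr0//.
  by rewrite -subset0 => x; rewrite /ysection/= !in_setE/= ltxx => -[[]].
rewrite (_ : ysection _ _ = ([set` `]- (w * y / h), w * y / h[] : set R)); last first.
  have zE : w * y = h * (w * y / h) by field; exact: lt0r_neq0.
  move: (w * y / h) zE => z zE.
  apply/seteqP; split => x; rewrite /ysection/= !in_setE/= in_itv/= zE -mulrN !ltr_pM2l//.
    by move=> [_ [-> ->]].
  by move=> /andP[-> ->].
rewrite lebesgue_measure_itv/= lte_fin.
case: ifPn => [_|].
  by rewrite -EFinB; congr (_%:E); field; exact: lt0r_neq0.
have : 0 <= w * y / h by rewrite divr_ge0 ?mulr_ge0 ?(ltW y0) ?(ltW h0).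
rewrite -leNgt => ? ?; have -> : 2 * w / h * y = 2 * (w * y / h) by ring.
by congr (_%:E); lra.
Qed.
End planar.

(** * Circular segments against sectors *)

(** The circumradius of the equilateral triangle of side 2: no point is closer
    than this to three points at mutual distances at least 2 (dist2_three). *)
Definition circ_rad {R : realType} : R := 2 / Num.sqrt 3.

(** The proportion of a circular sector of opening pi / 3 that lies beyond its
    chord.  Its complement in the area of the disc of radius circ_rad is the area of
    the hexagon circumscribed about the unit disc. *)
Definition lens_ratio {R : realType} : R := 1 - 3 * Num.sqrt 3 / (2 * pi).

Section slices.
Context {R : realType}.
Local Notation RR := (measurableTypeR R).
Local Notation q := (Num.sqrt (3 : R)).
Local Notation rad := (@circ_rad R).
Local Notation kap := (@lens_ratio R).

Lemma rad_sqr : rad ^+ 2 = 4 / 3.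
Proof. by rewrite /circ_rad expr_div_n sqrt3_sqr; lra. Qed.

Lemma rad_gt0 : 0 < rad.
Proof. by rewrite divr_gt0 ?sqrt3_gt0. Qed.

Lemma rad_cos_pi6 : rad * cos (pi / 6) = 1.
Proof. rewrite cos_pi6 /circ_rad; field; exact: lt0r_neq0 sqrt3_gt0. Qed.

Lemma lens_ratio_ge0 : 0 <= kap.
Proof.
have p0 := pi_gt0 R; have p3 := @pi_ge3 R.
rewrite subr_ge0 ler_pdivrMr ?mulr_gt0//.
have q0 := @sqrt3_gt0 R; have q2 := @sqrt3_sqr R.
nra.
Qed.

(** The part of the disc about 0 nearer to c than to 0. *)
Definition disk_segment (c : RR * RR) : set (RR * RR) :=
  [set v | v.1 ^+ 2 + v.2 ^+ 2 <= rad ^+ 2 /\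
    (c.1 ^+ 2 + c.2 ^+ 2) / 2 <= v.1 * c.1 + v.2 * c.2].

(** The cone over the arc that lies strictly nearer to c than to 0.  Strictness is
    what later makes the regions facing two neighbours disjoint. *)
Definition disk_sector (c : RR * RR) : set (RR * RR) :=
  [set v | v.1 ^+ 2 + v.2 ^+ 2 <= rad ^+ 2 /\
    (c.1 ^+ 2 + c.2 ^+ 2) / 2 * Num.sqrt (v.1 ^+ 2 + v.2 ^+ 2) < rad * (v.1 * c.1 + v.2 * c.2)].

Lemma measurable_disk_segment c : measurable (disk_segment c).
Proof. rewrite /disk_segment; mset. Qed.

Lemma measurable_disk_sector c : measurable (disk_sector c).
Proof. rewrite /disk_sector; mset. Qed.

Lemma in_sector (r h w x y : R) : 0 < r -> 0 < h -> h ^+ 2 + w ^+ 2 = r ^+ 2 -> 0 <= w -> 0 < y ->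
  `|h * x| < w * y -> h * Num.sqrt (x ^+ 2 + y ^+ 2) < r * y.
Proof.
move=> r0 h0 hw w0 y0 H.
have ry0 : 0 <= r * y by rewrite mulr_ge0 ?ltW.
rewrite -[ltLHS]ger0_norm ?mulr_ge0 ?sqrtr_ge0 ?(ltW h0)// -[ltRHS]ger0_norm//.
rewrite -ltr_sqr ?nnegrE ?normr_ge0// !real_normK ?num_real// !exprMn.
rewrite sqr_sqrtr ?addr_ge0 ?sqr_ge0// -hw.
have : (h * x) ^+ 2 < (w * y) ^+ 2.
  by rewrite -(real_normK (num_real (h * x))) ltr_sqr ?nnegrE// ?mulr_ge0// ltW.
rewrite !exprMn; lra.
Qed.

(** For a chord at distance h >= 1 the opening angle 2 b of the sector is at most
    pi / 3.  The segment is the sector without a triangle, and the ratio of triangle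
    to sector is sin (2 b) / (2 b), smallest at the largest angle. *)
Lemma area_segment_le_sector_axis (D : R) : 2 <= D ->
  (leb2 (disk_segment (0%R : RR, D : RR)) <= kap%:E * leb2 (disk_sector (0%R : RR, D : RR)))%E.
Proof.
move=> D2.
have r0 := rad_gt0; have r2 := rad_sqr.
have p0 := pi_gt0 R.
have D0 : 0 < D by lra.
have [Dr|Dr] := ltP (2 * rad) D.
  rewrite (_ : disk_segment _ = set0) ?measure0.
    by rewrite mule_ge0 ?lee_fin ?lens_ratio_ge0.
  have aux (x y : R) : x ^+ 2 + y ^+ 2 <= rad ^+ 2 -> D ^+ 2 / 2 <= y * D -> False.
    move=> H1 H2.
    have yD : D / 2 <= y by rewrite -(ler_pM2r D0); lra.
    have : rad ^+ 2 < y ^+ 2 by rewrite ltr_sqr ?nnegrE; lra.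
    have := sqr_ge0 x; lra.
  by rewrite -subset0 => -[x y] /= [H1]; rewrite mulr0 expr0n/= !add0r => /(aux _ _ H1).
(* h is the distance of the chord from the centre, b half the opening angle and
   w half the length of the chord. *)
pose h := D / 2.
have hD (y : R) : (D ^+ 2 / 2 <= y * D) = (h <= y).
  by rewrite -[RHS](ler_pM2r D0) /h expr2 mulrAC.
have h1 : 1 <= h by rewrite /h; lra.
have hr : h <= rad by rewrite /h; lra.
have h_gt0 : 0 < h by lra.
pose b := acos (h / rad).
have hr01 : -1 <= h / rad <= 1.
  by rewrite ler_pdivrMr// mul1r hr andbT (@le_trans _ _ 0)// divr_ge0 ?ltW.
have cb : cos b = h / rad by rewrite /b acosK// in_itv.
have rcb : rad * cos b = h by rewrite cb mulrC divfK ?gt_eqF.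
have b0 : 0 <= b by rewrite acos_ge0.
have bpi : b <= pi by rewrite acos_lepi.
have b6 : b <= pi / 6.
  rewrite leNgt; apply/negP => lt6.
  have : cos b < cos (pi / 6).
    by rewrite ltr_cos ?in_itv/=; [|apply/andP; split; lra|apply/andP; split; lra].
  by rewrite -(ltr_pM2l r0) rcb rad_cos_pi6; lra.
have s0 : 0 <= sin b by apply: sin_ge0_pi; apply/andP; split; lra.
pose w := rad * sin b.
have w0 : 0 <= w by rewrite mulr_ge0// ltW.
have hw : h ^+ 2 + w ^+ 2 = rad ^+ 2.
  by rewrite -rcb /w (exprMn 2 rad) (exprMn 2 rad) sin2cos2; ring.
have b02 : 0 <= b <= pi / 2 by apply/andP; split; lra.
pose S' : set (RR * RR) := [set p | p.1 ^+ 2 + p.2 ^+ 2 <= rad ^+ 2 /\ h < p.2].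
pose Tr : set (RR * RR) := [set p | (p.2 <= h /\ 0 < p.2) /\ (h * p.1 < w * p.2 /\ - (w * p.2) < h * p.1)].
have mS' : measurable S' by rewrite /S'; mset.
have mTr : measurable Tr by rewrite /Tr; mset.
rewrite (@area_segment _ rad b)//; last 3 first.
- exact: ltW.
- by move=> [x y] /=; rewrite rcb /disk_segment/= mulr0 expr0n/= !add0r hD => -[-> /ltW].
- by move=> [x y] /=; rewrite rcb /disk_segment/= mulr0 expr0n/= !add0r hD.
(* The sector splits into the segment and a triangle of area w h. *)
have key : ((rad ^+ 2 * (b - sin b * cos b))%:E + (w * h)%:E <= leb2 (disk_sector (0%R : RR, D : RR)))%E.
  rewrite -(@area_triangle _ h w)// -/Tr.
  rewrite -(@area_segment _ rad b S')//; last 3 first.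
  - exact: ltW.
  - by move=> [x y] /=; rewrite rcb.
  - by move=> [x y] /=; rewrite rcb => -[? ?]; split => //; exact: ltW.
  rewrite -measureU//; last first.
    by rewrite -subset0 => -[x y] [[_ /= H1] [[/= H2 _] _]]; have := lt_le_trans H1 H2; rewrite ltxx.
  apply: le_measure; rewrite ?inE//.
  - exact: measurableU.
  - exact: measurable_disk_sector.
  have inS' (x y : R) : x ^+ 2 + y ^+ 2 <= rad ^+ 2 -> h < y ->
      0 < y /\ `|h * x| < w * y.
    move=> H1 H2; split; first lra.
    have xw : `|x| < w.
      rewrite -ltr_sqr ?nnegrE// real_normK ?num_real//.
      have : h ^+ 2 < y ^+ 2 by rewrite ltr_sqr ?nnegrE; lra.
      lra.
    rewrite normrM (gtr0_norm h_gt0).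
    have := normr_ge0 x; nra.
  have inTr (x y : R) : y <= h -> 0 < y -> `|h * x| < w * y ->
      x ^+ 2 + y ^+ 2 <= rad ^+ 2.
    move=> H1 H2 H3; have : (h * x) ^+ 2 < (w * y) ^+ 2.
      by rewrite -(real_normK (num_real (h * x))) ltr_sqr ?nnegrE// mulr_ge0// ltW.
    rewrite (exprMn 2 h) (exprMn 2 w) -hw => H4.
    have : y ^+ 2 <= h ^+ 2 by rewrite ler_sqr ?nnegrE; lra.
    have := sqr_ge0 w; have : 0 < h ^+ 2 by rewrite exprn_gt0.
    nra.
  have H (x y : R) : 0 < y -> x ^+ 2 + y ^+ 2 <= rad ^+ 2 -> `|h * x| < w * y ->
      disk_sector (0%R : RR, D : RR) (x, y).
    move=> y0 H1 H2; split => //=; rewrite mulr0 expr0n/= !add0r.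
    have := in_sector r0 h_gt0 hw w0 y0 H2; rewrite /h => H3; nra.
  move=> [x y] [[/= H1 H2]|[[/= H1 H2] [/= H3 H4]]].
    by have [y0 H3] := inS' _ _ H1 H2; exact: H.
  have xy : `|h * (x : R)| < w * y by rewrite ltr_norml H3 H4.
  by apply: H => //; exact: inTr.
apply: (le_trans _ (lee_wpmul2l _ key)); last by rewrite lee_fin lens_ratio_ge0.
rewrite -EFinD -EFinM lee_fin.
have wh : w * h = rad ^+ 2 * (sin b * cos b) by rewrite -rcb /w; ring.
rewrite wh -mulrDr subrK mulrCA ler_pM2l ?exprn_gt0//.
have := @sin_cos_ge_chord R b; rewrite b0 b6 => /(_ isT).
rewrite /lens_ratio; lra.
Qed.

Lemma area_segment_le_sector (c : RR * RR) : 4 <= c.1 ^+ 2 + c.2 ^+ 2 ->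
  (leb2 (disk_segment c) <= kap%:E * leb2 (disk_sector c))%E.
Proof.
case: c => a b /= ab.
pose D := Num.sqrt (a ^+ 2 + b ^+ 2).
have D2 : D ^+ 2 = a ^+ 2 + b ^+ 2 by rewrite sqr_sqrtr; lra.
have Dge : 2 <= D.
  by rewrite -[leLHS]ger0_norm// -sqrtr_sqr ler_sqrt; lra.
have D0 : 0 < D by lra.
have [mg hg] : measure_preserving (@leb2 R) (rot2 (b / D) (a / D)).
  by apply: mp_rot2; rewrite !expr_div_n D2 -mulrDl addrC divff// gt_eqF//; lra.
have norm v : (rot2 (b / D) (a / D) v).1 ^+ 2 + (rot2 (b / D) (a / D) v).2 ^+ 2 = v.1 ^+ 2 + v.2 ^+ 2.
  rewrite /rot2 /=.
  transitivity ((a ^+ 2 + b ^+ 2) / D ^+ 2 * (v.1 ^+ 2 + v.2 ^+ 2)); first by field; exact: lt0r_neq0.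
  by rewrite D2 divff ?mul1r// gt_eqF//; lra.
have dot v : (rot2 (b / D) (a / D) v).2 * D = v.1 * a + v.2 * b.
  by rewrite /rot2/=; field; exact: lt0r_neq0.
have -> : disk_segment (a, b) = rot2 (b / D) (a / D) @^-1` disk_segment (0%R : RR, D : RR).
  by apply/funext => v; rewrite /disk_segment/= norm dot mulr0 expr0n/= !add0r D2.
have -> : disk_sector (a, b) = rot2 (b / D) (a / D) @^-1` disk_sector (0%R : RR, D : RR).
  by apply/funext => v; rewrite /disk_sector/= norm dot mulr0 expr0n/= !add0r D2.
rewrite !hg; [|exact: measurable_disk_sector|exact: measurable_disk_segment].
exact: area_segment_le_sector_axis.
Qed.
End slices.

(** * Two tubes in adapted coordinates *)

(** In these coordinates the first axis is the part [al1, be1] of the third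
    coordinate axis, and the second one the part [al2, be2] of the line through
    (0, b, 0) with direction (S, 0, C).  T is the tangent of half the angle between
    them, and the slices perpendicular to the bisector are the planes on which
    l + T s is constant. *)
Section pair_frame.
Context {R : realType}.
Local Notation RR := (measurableTypeR R).
Local Notation mu := (@lebesgue_measure R).
Local Notation rad := (@circ_rad R).
Local Notation kap := (@lens_ratio R).
Variables (al1 be1 al2 be2 S C b : R).
Hypothesis SC : S ^+ 2 + C ^+ 2 = 1.
Hypothesis C0 : 0 <= C.
Hypothesis sep : forall x y, al1 <= x <= be1 -> al2 <= y <= be2 ->
  4 <= (y * S) ^+ 2 + b ^+ 2 + (x - y * C) ^+ 2.

Let T : R := S / (1 + C).

Lemma tan_half : [/\ T * (1 + C) = S, C + T * S = 1, S - T * C = T & `|T| <= 1].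
Proof.
have C1 : 1 + C != 0 by rewrite gt_eqF// ltr_pwDl.
have TS : T * (1 + C) = S by rewrite /T divfK.
have CTS : C + T * S = 1.
  apply: (mulIf C1); transitivity (C * (1 + C) + T * (1 + C) * S); first by ring.
  by rewrite TS mul1r -[in RHS]SC; ring.
split => //; first by rewrite -{1}TS; ring.
have C1' : 0 < 1 + C by rewrite ltr_pwDl.
have S2 : S ^+ 2 <= 1 by rewrite -SC lerDl sqr_ge0.
have : `|S| <= 1 by rewrite -ler_sqr ?nnegrE// real_normK ?num_real// expr1n.
rewrite -TS normrM (gtr0_norm C1') => H; have := C0 => C0'.
have := normr_ge0 T; nra.
Qed.

(** The points that are nearer to the second line, and whose feet on both segments
    stay away from the end points by twice rad. *)
Definition frame_half_lens : set (RR * RR * RR) :=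
  [set p | (p.1.1 ^+ 2 + p.1.2 ^+ 2 <= rad ^+ 2 /\
            (p.1.2 - b) ^+ 2 + (p.1.1 * C - p.2 * S) ^+ 2 <= p.1.1 ^+ 2 + p.1.2 ^+ 2) /\
     ((al1 + 2 * rad <= p.2 /\ p.2 <= be1 - 2 * rad) /\
      (al2 + 2 * rad <= p.1.1 * S + p.2 * C /\ p.1.1 * S + p.2 * C <= be2 - 2 * rad))].

(** Heights of the slices through the half-lens: a slice and the feet of its points
    differ by at most rad, since the slope T is at most 1. *)
Definition frame_range : set R :=
  [set x | (al1 + rad <= x /\ x <= be1 - rad) /\ (al2 + rad <= x /\ x <= be2 - rad)].

Definition lens_slices : set (RR * RR * RR) :=
  [set p | frame_range p.2 /\ disk_segment (p.2 * S : RR, b : RR) p.1].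

Definition sector_slices : set (RR * RR * RR) :=
  [set p | frame_range p.2 /\ disk_sector (p.2 * S : RR, b : RR) p.1].

(** Difference of height between a point and the slice through its radial
    projection onto the tube of radius rad.  The projection is perpendicular to the
    first axis, hence does not stay in a slice. *)
Definition arc_shift (v : RR * RR) : RR :=
  rad * v.1 * (Num.sqrt (v.1 ^+ 2 + v.2 ^+ 2))^-1 * T.

(** The points whose radial projection lies on an arc of a slice facing the second
    line. *)
Definition frame_sector : set (RR * RR * RR) :=
  [set p | sector_slices (p.1, p.2 + arc_shift p.1)].

Lemma measurable_frame_half_lens : measurable frame_half_lens.
Proof. rewrite /frame_half_lens; mset. Qed.

Lemma measurable_lens_slices : measurable lens_slices.
Proof. rewrite /lens_slices /frame_range /disk_segment/=; mset. Qed.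

Lemma measurable_sector_slices : measurable sector_slices.
Proof. rewrite /sector_slices /frame_range /disk_sector/=; mset. Qed.

Lemma measurable_arc_shift : measurable_fun setT arc_shift.
Proof.
have mn : measurable_fun setT (fun v : RR * RR => (Num.sqrt (v.1 ^+ 2 + v.2 ^+ 2))^-1).
  apply: measurable_fun_invr; first by move=> v; exact: sqrtr_ge0.
  mfun.
apply: measurable_funM; last exact: measurable_cst.
apply: measurable_funM; last exact: mn.
mfun.
Qed.

Lemma measurable_frame_sector : measurable frame_sector.
Proof.
have [mg _] := @mp_shear_snd R _ _ (@leb2 R) arc_shift measurable_arc_shift.
rewrite -[X in measurable X]setTI; exact: mg _ measurable_sector_slices.
Qed.

(** The centres of the two discs of a slice are at distance at least 2.  For large
    abscissa this is obvious; otherwise compare with a pair of points of the two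
    segments. *)
Lemma slice_centre_far x : frame_range x -> 4 <= (x * S) ^+ 2 + b ^+ 2.
Proof.
have r0 := @rad_gt0 R; have r2 := @rad_sqr R.
move=> [[h1 h2] [h3 h4]].
have [TS CTS STC T1] := tan_half; have SC' := SC; have C0' := C0.
have [xS|xS] := ltP (2 * rad) `|x * S|.
  have : (2 * rad) ^+ 2 < `|x * S| ^+ 2 by rewrite ltr_sqr ?nnegrE//; lra.
  rewrite real_normK ?num_real// exprMn r2.
  by have := sqr_ge0 b; lra.
(* The points at height y on the two axes both lie on the segments, since y is
   within rad of x; they are no farther apart than the centres of the slice. *)
pose y := x * (1 + C) / 2.
have yx : `|x - y| <= rad.
  rewrite (_ : x - y = x * S * T / 2); last first.
    by rewrite /y (_ : x * S * T = x * (T * S)); [rewrite (_ : T * S = 1 - C); [field|lra]|ring].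
  rewrite normrM (normrM (x * S)) (@ger0_norm _ (2^-1)) ?invr_ge0//.
  have := normr_ge0 T; have := normr_ge0 (x * S); nra.
move: yx; rewrite ler_norml => /andP[y1 y2].
have := sep (x := y) (y := y).
have -> : al1 <= y <= be1 by apply/andP; split; lra.
have -> : al2 <= y <= be2 by apply/andP; split; lra.
move=> /(_ isT isT) H; apply: (le_trans H).
rewrite -subr_ge0.
suff -> : (x * S) ^+ 2 + b ^+ 2 - ((y * S) ^+ 2 + b ^+ 2 + (y - y * C) ^+ 2) = x ^+ 2 * (1 - C) ^+ 2 * (1 + C) / 2.
  by rewrite divr_ge0// mulr_ge0 ?addr_ge0// mulr_ge0 ?sqr_ge0.
rewrite !exprMn (_ : S ^+ 2 = 1 - C ^+ 2); last by lra.
by rewrite /y; field.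
Qed.

Lemma lens_le_sector : (leb3 lens_slices <= kap%:E * leb3 sector_slices)%E.
Proof.
rewrite /leb3 !product_measure_ysection; [|exact: measurable_sector_slices|exact: measurable_lens_slices].
rewrite -ge0_integralZl//; last 2 first.
- exact: (measurable_fun_ysection (@leb2 R) measurable_sector_slices).
- by rewrite lee_fin lens_ratio_ge0.
apply: ge0_le_integral => //.
- exact: (measurable_fun_ysection (@leb2 R) measurable_lens_slices).
- apply: measurable_funeM.
  exact: (measurable_fun_ysection (@leb2 R) measurable_sector_slices).
move=> x _.
have [xr|nxr] := pselect (frame_range x); last first.
  rewrite (_ : ysection _ _ = set0) ?measure0.
    by rewrite mule_ge0// lee_fin lens_ratio_ge0.
  by rewrite -subset0 => v; rewrite /ysection/= in_setE/= => -[].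
rewrite (_ : ysection lens_slices x = disk_segment (x * S : RR, b : RR)); last first.
  apply/seteqP; split => v; rewrite /ysection/= in_setE/=; first by case.
  by [].
rewrite (_ : ysection sector_slices x = disk_sector (x * S : RR, b : RR)); last first.
  apply/seteqP; split => v; rewrite /ysection/= in_setE/=; first by case.
  by [].
exact/area_segment_le_sector/slice_centre_far.
Qed.

(** In the slice at height l + T s both tubes are discs: the distance to the second
    line is the plane distance to (x S, b), because C + T S = 1. *)
Lemma frame_half_lens_sub : frame_half_lens `<=` (fun p => (p.1, p.2 + T * p.1.1)) @^-1` lens_slices.
Proof.
have r0 := @rad_gt0 R.
have [TS CTS STC T1] := tan_half; have SC' := SC; have C0' := C0.
suff H (s y l : R) : s ^+ 2 + y ^+ 2 <= rad ^+ 2 ->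
   (y - b) ^+ 2 + (s * C - l * S) ^+ 2 <= s ^+ 2 + y ^+ 2 ->
   al1 + 2 * rad <= l -> l <= be1 - 2 * rad ->
   al2 + 2 * rad <= s * S + l * C -> s * S + l * C <= be2 - 2 * rad ->
   lens_slices (s : RR, y : RR, l + T * s : RR).
  by move=> [[s y] l] [[/= ? ?] [[? ?] [? ?]]]; exact: H.
move=> H1 H2 H3 H4 H5 H6.
have d2 : s * C - l * S = s - (l + T * s) * S.
  by rewrite -[X in _ = X - _]mul1r -{1}CTS; ring.
have norm_le (z : R) : z ^+ 2 <= rad ^+ 2 -> `|z| <= rad.
  by move=> zr; rewrite -ler_sqr ?nnegrE ?(ltW r0)// real_normK ?num_real.
have s1 : `|s| <= rad by apply: norm_le; have := sqr_ge0 y; lra.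
have s2 : `|s - (l + T * s) * S| <= rad.
  by apply: norm_le; rewrite -d2; have := sqr_ge0 (y - b); lra.
have Tmul (z : R) : `|z| <= rad -> - rad <= T * z <= rad.
  move=> zr; rewrite -ler_norml normrM.
  have := normr_ge0 T; have := normr_ge0 z; nra.
have /andP[a1 a2] := Tmul _ s1.
have /andP[a3 a4] := Tmul _ s2.
(* Position along the second axis in terms of the slice and of the abscissa
   relative to the second centre. *)
have l2 : s * S + l * C = (l + T * s) + T * (s - (l + T * s) * S).
  rewrite -{1}TS (_ : l * C = l * (1 - T * S)); last by congr (_ * _); lra.
  rewrite (_ : T * (1 + C) = T * (1 + (1 - T * S))); first by ring.
  by congr (_ * (1 + _)); lra.
split => /=; first by split; split; lra.
split => //=.
move: H2; rewrite d2; lra.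
Qed.

(** Two fibrewise translations of the third coordinate preserve volume: the linear
    one turns half-lens into slices, and arc_shift turns sector slices into the
    region defined by radial projection. *)
Lemma frame_half_lens_le : (leb3 frame_half_lens <= kap%:E * leb3 frame_sector)%E.
Proof.
have mT : measurable_fun setT (fun v : RR * RR => T * v.1 : RR) by mfun.
have [mg hg] := @mp_shear_snd R _ _ (@leb2 R) _ mT.
have [_ ha] := @mp_shear_snd R _ _ (@leb2 R) arc_shift measurable_arc_shift.
apply: (@le_trans _ _ (leb3 lens_slices)).
  rewrite [leRHS]/leb3 -(hg _ measurable_lens_slices); apply: (@le_measure _ _ _ (@leb3 R)); rewrite ?inE.
  - exact: measurable_frame_half_lens.
  - by rewrite -[X in measurable X]setTI; exact: mg _ measurable_lens_slices.
  - exact: frame_half_lens_sub.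
apply: (le_trans lens_le_sector).
by rewrite /leb3 -(ha _ measurable_sector_slices).
Qed.

(** What matters about the region: the radial projection of its points is within
    rad of the second segment. *)
Lemma frame_sector_spec (v1 v2 l : R) : frame_sector (v1 : RR, v2 : RR, l : RR) ->
  let n := Num.sqrt (v1 ^+ 2 + v2 ^+ 2) in
  [/\ 0 < n, n <= rad, al1 <= l <= be1 &
    exists2 y, al2 <= y <= be2 &
      (rad * v1 / n - y * S) ^+ 2 + (rad * v2 / n - b) ^+ 2 + (l - y * C) ^+ 2 < rad ^+ 2].
Proof.
have r0 := @rad_gt0 R.
have [TS CTS STC T1] := tan_half; have SC' := SC; have C0' := C0.
rewrite /frame_sector /sector_slices /disk_sector /frame_range /arc_shift /=.
set n := Num.sqrt _.
set s := rad * v1 / n; set x := l + s * T.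
move=> [[[h1 h2] [h3 h4]] [H1 H2]].
have n0 : 0 <= n by exact: sqrtr_ge0.
have n2 : n ^+ 2 = v1 ^+ 2 + v2 ^+ 2 by rewrite sqr_sqrtr// addr_ge0 ?sqr_ge0.
have n_gt0 : 0 < n.
  rewrite lt_neqAle n0 andbT; apply/eqP => nE; move: H2.
  rewrite -nE mulr0.
  have : v1 ^+ 2 + v2 ^+ 2 = 0 by rewrite -n2 -nE expr0n.
  move/eqP; rewrite paddr_eq0 ?sqr_ge0// !sqrf_eq0 => /andP[/eqP -> /eqP ->].
  by rewrite !mul0r addr0 mulr0 ltxx.
have nr : n <= rad by rewrite -ler_sqr ?nnegrE ?n2 ?(ltW r0).
pose y' := rad * v2 / n.
have sy : s ^+ 2 + y' ^+ 2 = rad ^+ 2.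
  rewrite /s /y' (expr_div_n (rad * v1)) (expr_div_n (rad * v2)) !(exprMn 2 rad) -mulrDl -mulrDr -n2 mulfK//.
  by rewrite gt_eqF// exprn_gt0.
(* (s, y') is the point v pushed out to the circle of radius rad. *)
have dot : rad * (v1 * (x * S) + v2 * b) = (s * (x * S) + y' * b) * n.
  by rewrite /s /y'; field; exact: lt0r_neq0.
have beyond : (x * S) ^+ 2 + b ^+ 2 < 2 * (s * (x * S) + y' * b).
  move: H2; rewrite dot ltr_pM2r//; lra.
have dist : (s - x * S) ^+ 2 + (y' - b) ^+ 2 < rad ^+ 2.
  by move: beyond; rewrite -sy !expr2; lra.
have norm_le (z : R) : z ^+ 2 <= rad ^+ 2 -> `|z| <= rad.
  by move=> zr; rewrite -ler_sqr ?nnegrE ?(ltW r0)// real_normK ?num_real.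
have Tmul (z : R) : `|z| <= rad -> - rad <= T * z <= rad.
  move=> zr; rewrite -ler_norml normrM.
  have := normr_ge0 T; have := normr_ge0 z; nra.
have s1 : `|s| <= rad by apply: norm_le; have := sqr_ge0 y'; lra.
have s2 : `|s - x * S| <= rad by apply: norm_le; have := sqr_ge0 (y' - b); lra.
have /andP[a1 a2] := Tmul _ s1.
have /andP[a3 a4] := Tmul _ s2.
have lE : l = x - T * s by rewrite /x; ring.
split => //; first by apply/andP; split; lra.
exists (x + T * (s - x * S)); first by apply/andP; split; lra.
move: dist; rewrite -/y'; congr (_ < _).
set Y := x + _.
have YE : Y = s * S + l * C.
  transitivity (x * C + s * T); last by rewrite -STC lE; ring.
  by rewrite /Y (_ : C = 1 - T * S); [ring | lra].
have d2 : s * C - l * S = s - x * S.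
  transitivity (s * (C + T * S) - x * S); first by rewrite lE; ring.
  by rewrite CTS mulr1.
rewrite -d2; have C2 : C ^+ 2 = 1 - S ^+ 2 by lra.
transitivity ((s * C - l * S) ^+ 2 + (s * S + l * C - Y) ^+ 2
    + (s ^+ 2 + l ^+ 2 - Y ^+ 2) * (1 - S ^+ 2 - C ^+ 2) + (y' - b) ^+ 2).
  by rewrite YE subrr C2; ring.
by ring.
Qed.
End pair_frame.

(** * Rigid motions *)

Section rigid.
Context {R : realType}.
Local Notation RR := (measurableTypeR R).
Local Notation mu := (@lebesgue_measure R).
Local Notation P3 := (R * R * R)%type.

Definition dist2 (p q : P3) : R :=
  (p.1.1 - q.1.1) ^+ 2 + (p.1.2 - q.1.2) ^+ 2 + (p.2 - q.2) ^+ 2.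

(** Affinity is asked along segments only, which is what transports axis points. *)
Definition rigid (g : P3 -> P3) : Prop :=
  [/\ measure_preserving (@leb3 R) g,
      forall p q, dist2 (g p) (g q) = dist2 p q &
      forall p q s, g (p + s *: (q - p)) = g p + s *: (g q - g p)].

Lemma rigid_comp f g : rigid f -> rigid g -> rigid (f \o g).
Proof.
move=> [mf df af] [mg dg ag]; split; first exact: measure_preserving_comp.
  by move=> p q; rewrite /= df dg.
by move=> p q s; rewrite /= ag af.
Qed.

Lemma rigid_translation (a b c : R) :
  rigid (fun p => (p.1.1 + a, p.1.2 + b, p.2 + c)).
Proof.
split.
- have m1 := @mp_shear_fst R _ _ mu (fun=> a : RR) (measurable_cst _).
  have m2 := @mp_shear_snd R _ _ mu (fun=> b : RR) (measurable_cst _).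
  have m12 := @mp_fst R _ _ _ _ (@leb2 R) mu _ (measure_preserving_comp m1 m2).
  have m3 := @mp_shear_snd R _ _ (@leb2 R) (fun=> c : RR) (measurable_cst _).
  exact: (measure_preserving_comp m12 m3).
- by move=> p q; rewrite /dist2/=; congr (_ ^+ 2 + _ ^+ 2 + _ ^+ 2); ring.
- move=> [[x y] z] [[x' y'] z'] s /=.
  congr (_, _, _) => /=; rewrite /GRing.scale/=; ring.
Qed.

Lemma rigid_rot_xy (c s : R) : c ^+ 2 + s ^+ 2 = 1 ->
  rigid (fun p => (c * p.1.1 - s * p.1.2, s * p.1.1 + c * p.1.2, p.2)).
Proof.
move=> cs; split.
- exact: (mp_rot2_fst cs).
- move=> [[x y] z] [[x' y'] z']; rewrite /dist2/=; congr (_ + _).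
  transitivity ((c ^+ 2 + s ^+ 2) * ((x - x') ^+ 2 + (y - y') ^+ 2)); first by ring.
  by rewrite cs mul1r.
- move=> [[x y] z] [[x' y'] z'] k /=.
  congr (_, _, _) => /=; rewrite /GRing.scale/=; ring.
Qed.

Lemma rigid_rot_yz (c s : R) : c ^+ 2 + s ^+ 2 = 1 ->
  rigid (fun p => (p.1.1, c * p.1.2 - s * p.2, s * p.1.2 + c * p.2)).
Proof.
move=> cs; split.
- exact: (mp_lift_yz (mp_rot2 cs)).
- move=> [[x y] z] [[x' y'] z']; rewrite /dist2/=; rewrite -!addrA; congr (_ + _).
  transitivity ((c ^+ 2 + s ^+ 2) * ((y - y') ^+ 2 + (z - z') ^+ 2)); first by ring.
  by rewrite cs mul1r.
- move=> [[x y] z] [[x' y'] z'] k /=.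
  congr (_, _, _) => /=; rewrite /GRing.scale/=; ring.
Qed.

Lemma exists_rotation (x y : R) : exists c s : R, c ^+ 2 + s ^+ 2 = 1 /\
  (c * x - s * y = 0 /\ s * x + c * y = Num.sqrt (x ^+ 2 + y ^+ 2)).
Proof.
set n := Num.sqrt _.
have n2 : n ^+ 2 = x ^+ 2 + y ^+ 2 by rewrite sqr_sqrtr// addr_ge0 ?sqr_ge0.
have [n0|n0] := eqVneq n 0.
  exists 1, 0; move: n2; rewrite n0 expr0n/= => /esym/eqP.
  rewrite paddr_eq0 ?sqr_ge0// !sqrf_eq0 => /andP[/eqP -> /eqP ->].
  by split; [ring|split; ring].
exists (y / n), (x / n); split; [|split].
- by rewrite !expr_div_n -mulrDl addrC -n2 divff// expf_neq0.
- by field.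
- transitivity ((x ^+ 2 + y ^+ 2) / n); first by field.
  by rewrite -n2 expr2 mulfK.
Qed.

(** A rotation about the third axis removes the first coordinate of b - a, a
    rotation about the first one then removes the second. *)
Lemma exists_axis_frame (a b : P3) (t : R) : 0 <= t -> dist2 a b = t ^+ 2 ->
  exists2 g, rigid g & g a = (0, 0, 0) /\ g b = (0, 0, t).
Proof.
move=> t0 dab.
have [c1 [s1 [e1 [h1 h1']]]] := exists_rotation (b.1.1 - a.1.1) (b.1.2 - a.1.2).
set n := Num.sqrt _ in h1'.
have [c2 [s2 [e2 [h2 h2']]]] := exists_rotation n (b.2 - a.2).
exists ((fun p => (p.1.1, c2 * p.1.2 - s2 * p.2, s2 * p.1.2 + c2 * p.2)) \o
  ((fun p => (c1 * p.1.1 - s1 * p.1.2, s1 * p.1.1 + c1 * p.1.2, p.2)) \o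
    (fun p => (p.1.1 + - a.1.1, p.1.2 + - a.1.2, p.2 + - a.2)))).
  by apply: rigid_comp; [exact: rigid_rot_yz|apply: rigid_comp;
    [exact: rigid_rot_xy|exact: rigid_translation]].
rewrite /= !subrr; split; first by congr (_, _, _); ring.
rewrite h1 h1' h2 h2' /n sqr_sqrtr ?addr_ge0 ?sqr_ge0//.
congr (_, _, _); rewrite -[RHS]ger0_norm// -sqrtr_sqr -dab /dist2.
by congr Num.sqrt; ring.
Qed.

(** The hypothesis on the four distances says that the two directions form an angle
    of at most pi / 2.  This gives C >= 0, so that the slices are perpendicular to
    the bisector of the acute angle. *)
Lemma exists_pair_frame (a b a' b' : P3) (t : R) : 0 < t ->
  dist2 a b = t ^+ 2 -> dist2 a' b' = t ^+ 2 ->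
  dist2 a a' + dist2 b b' <= dist2 a b' + dist2 b a' ->
  exists2 g, rigid g & exists al al' S C h : R,
    [/\ S ^+ 2 + C ^+ 2 = 1, 0 <= C,
      g a = (0, 0, al), g b = (0, 0, al + t) &
      g a' = (al' * S, h, al' * C) /\ g b' = ((al' + t) * S, h, (al' + t) * C)].
Proof.
move=> t0 dab dab' acute.
have [g rg [ga gb]] := exists_axis_frame (ltW t0) dab.
have [_ dg _] := rg.
move: dab' acute; rewrite -(dg a' b') -(dg a a') -(dg b b') -(dg a b') -(dg b a') ga gb.
case ga' : (g a') => [[p1 p2] p3]; case gb' : (g b') => [[r1 r2] r3].
rewrite /dist2/= !sub0r => dab' acute.
pose C := (r3 - p3) / t.
have C0 : 0 <= C by rewrite divr_ge0// ?(ltW t0)//; nra.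
have r3E : r3 = p3 + t * C by rewrite /C; field; exact: lt0r_neq0.
pose S := Num.sqrt ((r2 - p2) ^+ 2 + (r1 - p1) ^+ 2) / t.
have S2 : S ^+ 2 = ((r2 - p2) ^+ 2 + (r1 - p1) ^+ 2) / t ^+ 2.
  by rewrite /S expr_div_n sqr_sqrtr ?addr_ge0 ?sqr_ge0.
have SC : S ^+ 2 + C ^+ 2 = 1.
  rewrite S2 /C expr_div_n -mulrDl.
  apply: (mulIf (x := t ^+ 2)); first by rewrite expf_neq0// gt_eqF.
  rewrite divfK ?expf_neq0 ?gt_eqF// mul1r -dab'; ring.
(* Parallel axes have no crossing point: the second one is then moved over the
   second coordinate axis, and no shift along the first axis is needed. *)
have [S0|S0] := eqVneq S 0.
- have [c [s [e [h1 h2]]]] := exists_rotation p1 p2.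
  exists ((fun p => (c * p.1.1 - s * p.1.2, s * p.1.1 + c * p.1.2, p.2)) \o g).
    by apply: rigid_comp => //; exact: rigid_rot_xy.
  have C1 : C = 1.
    have : C ^+ 2 = 1 ^+ 2 by move: SC; rewrite S0 expr0n/= add0r expr1n.
    by move/eqP; rewrite eqrXn2// => /eqP.
  have : S ^+ 2 = 0 by rewrite S0 expr0n.
  rewrite S2 => /eqP; rewrite mulf_eq0 invr_eq0 expf_eq0/= (gt_eqF t0) orbF.
  rewrite paddr_eq0 ?sqr_ge0// !sqrf_eq0 !subr_eq0 => /andP[/eqP r2E /eqP r1E].
  exists 0, p3, 0, 1, (Num.sqrt (p1 ^+ 2 + p2 ^+ 2)).
  rewrite /= ga gb ga' gb' /= r1E r2E r3E C1 h1 h2.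
  by split; [ring|by []|congr (_, _, _); ring|congr (_, _, _); ring|
     split; congr (_, _, _); ring].
have [c [s [e [h1 h2]]]] := exists_rotation (r2 - p2) (r1 - p1).
pose x1 := c * p2 - s * p1; pose y1 := s * p2 + c * p1.
(* The third coordinate is shifted so that the common perpendicular of the two
   lines is at height 0. *)
pose l := y1 / S.
(* -s instead of s: the second axis has to project onto the first coordinate
   axis, while exists_rotation aims at the second. *)
pose G := (fun p : P3 => (c * p.1.1 - (- s) * p.1.2, (- s) * p.1.1 + c * p.1.2, p.2)).
pose Z := (fun p : P3 => (p.1.1 + 0, p.1.2 + 0, p.2 + (l * C - p3))).
exists (Z \o (G \o g)).
  apply: rigid_comp; first exact: rigid_translation.
  by apply: rigid_comp => //; apply: rigid_rot_xy; rewrite sqrrN.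
have tS : t * S = s * (r2 - p2) + c * (r1 - p1).
  by rewrite h2 /S mulrC divfK// gt_eqF.
have lS : l * S = y1 by rewrite /l divfK.
exists (l * C - p3), l, S, C, (c * p2 - s * p1).
rewrite /= ga gb ga' gb' /Z /G /= r3E.
split=> //; first by congr (_, _, _); ring.
  by congr (_, _, _); ring.
split; congr (_, _, _).
- by rewrite lS /y1; ring.
- by ring.
- by ring.
- by rewrite mulrDl lS tS /y1; ring.
- by move: h1; lra.
- by ring.
Qed.
End rigid.

(** * Tubes around segments *)

Section tubes.
Context {R : realType}.
Local Notation RR := (measurableTypeR R).
Local Notation mu := (@lebesgue_measure R).
Local Notation P3 := (R * R * R)%type.
Local Notation rad := (@circ_rad R).
Local Notation kap := (@lens_ratio R).
Variable t : R.
Hypothesis t0 : 0 < t.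

(** Position on the axis of the foot of the perpendicular from p, measured from a.
    Written with the distances to the end points alone, it is visibly invariant under
    rigid motions. *)
Definition foot (a b p : P3) : R := (dist2 p a - dist2 p b + t ^+ 2) / (2 * t).

(** The squared distance of p to the line through a and b. *)
Definition axis_dist2 (a b p : P3) : R := dist2 p a - foot a b p ^+ 2.

Definition tube (r lo hi : R) (a b : P3) : set P3 :=
  [set p | axis_dist2 a b p <= r ^+ 2 /\ (lo <= foot a b p /\ foot a b p <= hi)].

Definition open_tube (r lo hi : R) (a b : P3) : set P3 :=
  [set p | axis_dist2 a b p < r ^+ 2 /\ (lo <= foot a b p /\ foot a b p <= hi)].

Lemma foot_rigid g a b p : rigid g -> foot (g a) (g b) (g p) = foot a b p.
Proof. by move=> [_ dg _]; rewrite /foot !dg. Qed.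

Lemma axis_dist2_rigid g a b p : rigid g -> axis_dist2 (g a) (g b) (g p) = axis_dist2 a b p.
Proof. by move=> rg; rewrite /axis_dist2 foot_rigid//; have [_ -> _] := rg. Qed.

Lemma foot_swap a b p : foot b a p = t - foot a b p.
Proof. by rewrite /foot; field; exact: lt0r_neq0. Qed.

Lemma axis_dist2_swap a b p : axis_dist2 b a p = axis_dist2 a b p.
Proof. by rewrite /axis_dist2 foot_swap /foot; field; exact: lt0r_neq0. Qed.

Lemma foot_axis al p : foot (0, 0, al) (0, 0, al + t) p = p.2 - al.
Proof. by rewrite /foot /dist2/=; field; exact: lt0r_neq0. Qed.

Lemma axis_dist2_axis al p : axis_dist2 (0, 0, al) (0, 0, al + t) p = p.1.1 ^+ 2 + p.1.2 ^+ 2.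
Proof. by rewrite /axis_dist2 foot_axis /dist2/=; ring. Qed.

Lemma foot_oblique al S C h p : S ^+ 2 + C ^+ 2 = 1 ->
  foot (al * S, h, al * C) ((al + t) * S, h, (al + t) * C) p = p.1.1 * S + p.2 * C - al.
Proof.
move=> SC; rewrite /foot /dist2/=.
transitivity ((2 * t * (p.1.1 * S + p.2 * C - al) + (t ^+ 2 + 2 * al * t) * (1 - (S ^+ 2 + C ^+ 2))) / (2 * t)).
  by congr (_ / _); ring.
by rewrite SC; field; exact: lt0r_neq0.
Qed.

Lemma axis_dist2_oblique al S C h p : S ^+ 2 + C ^+ 2 = 1 ->
  axis_dist2 (al * S, h, al * C) ((al + t) * S, h, (al + t) * C) p =
  (p.1.2 - h) ^+ 2 + (p.1.1 * C - p.2 * S) ^+ 2.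
Proof.
move=> SC; rewrite /axis_dist2 foot_oblique// /dist2/=.
transitivity ((p.1.2 - h) ^+ 2 + (p.1.1 * C - p.2 * S) ^+ 2
  + (p.1.1 ^+ 2 + p.2 ^+ 2 - al ^+ 2) * (1 - (S ^+ 2 + C ^+ 2))); first by ring.
by rewrite SC; ring.
Qed.

Lemma measurable_fun_dist2 (a : P3) : measurable_fun setT (fun p : RR * RR * RR => dist2 p a).
Proof. by rewrite /dist2; mfun. Qed.

Lemma measurable_fun_foot (a b : P3) : measurable_fun setT (fun p : RR * RR * RR => foot a b p).
Proof.
rewrite /foot; apply: measurable_funM; last exact: measurable_cst.
apply: measurable_funD; last exact: measurable_cst.
by apply: measurable_funB; exact: measurable_fun_dist2.
Qed.

Lemma measurable_fun_axis_dist2 (a b : P3) : measurable_fun setT (fun p : RR * RR * RR => axis_dist2 a b p).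
Proof.
apply: measurable_funB; first exact: measurable_fun_dist2.
by apply: measurable_funX; exact: measurable_fun_foot.
Qed.

Lemma measurable_tube r lo hi a b : measurable (tube r lo hi a b : set (RR * RR * RR)).
Proof.
have mfo := measurable_fun_foot a b; have maxis := measurable_fun_axis_dist2 a b.
apply: (@measurable_set_and _ _ (fun p => axis_dist2 a b p <= r ^+ 2)).
  by apply: measurable_set_le => //; exact: measurable_cst.
apply: (@measurable_set_and _ _ (fun p => lo <= foot a b p)).
  by apply: measurable_set_le => //; exact: measurable_cst.
by apply: measurable_set_le => //; exact: measurable_cst.
Qed.

Lemma measurable_open_tube r lo hi a b : measurable (open_tube r lo hi a b : set (RR * RR * RR)).
Proof.
have mfo := measurable_fun_foot a b; have maxis := measurable_fun_axis_dist2 a b.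
apply: (@measurable_set_and _ _ (fun p => axis_dist2 a b p < r ^+ 2)).
  by apply: measurable_set_lt => //; exact: measurable_cst.
apply: (@measurable_set_and _ _ (fun p => lo <= foot a b p)).
  by apply: measurable_set_le => //; exact: measurable_cst.
by apply: measurable_set_le => //; exact: measurable_cst.
Qed.

Lemma exists_frame a b : dist2 a b = t ^+ 2 ->
  exists2 g, rigid g &
    (forall p, foot a b p = (g p).2) /\
    (forall p, axis_dist2 a b p = (g p).1.1 ^+ 2 + (g p).1.2 ^+ 2).
Proof.
move=> dab; have [g rg [ga gb]] := exists_axis_frame (ltW t0) dab.
exists g => //; split => p.
  by have := foot_axis 0 (g p); rewrite add0r subr0 -(foot_rigid a b p rg) ga gb.
by have := axis_dist2_axis 0 (g p); rewrite add0r -(axis_dist2_rigid a b p rg) ga gb.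
Qed.

Lemma leb3_cylinder (D : set (RR * RR)) (x lo hi : R) : measurable D ->
  leb2 D = x%:E -> lo <= hi ->
  leb3 (D `*` [set` `[lo, hi]] : set (RR * RR * RR)) = (x * (hi - lo))%:E.
Proof.
move=> mD Dx lohi; rewrite /leb3 product_measure1E//.
rewrite [X in (X * _)%E]Dx [X in (_ * X)%E]lebesgue_measure_itv/= lte_fin.
move: lohi; rewrite le_eqVlt => /predU1P[->|->].
  by rewrite ltxx mule0 subrr mulr0.
by rewrite -EFinB -EFinM.
Qed.

Lemma leb3_tube r lo hi a b : dist2 a b = t ^+ 2 -> 0 <= r -> lo <= hi ->
  leb3 (tube r lo hi a b) = (pi * r ^+ 2 * (hi - lo))%:E.
Proof.
move=> dab r0 lohi; have [g [[mg hg] _ _] [gf gx]] := exists_frame dab.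
have mD : measurable [set v : RR * RR | v.1 ^+ 2 + v.2 ^+ 2 <= r ^+ 2] by mset.
rewrite -(leb3_cylinder mD (area_closed_disk r0) lohi).
set E := (X in _ = leb3 X).
have mE : measurable E by exact: measurableX.
rewrite -(hg E mE); congr (leb3 _); apply/seteqP; split => p; rewrite /E /tube/= gf gx in_itv/=.
  by move=> [? [-> ->]].
by move=> [? /andP[]].
Qed.

Lemma leb3_open_tube r lo hi a b : dist2 a b = t ^+ 2 -> 0 <= r -> lo <= hi ->
  leb3 (open_tube r lo hi a b) = (pi * r ^+ 2 * (hi - lo))%:E.
Proof.
move=> dab r0 lohi; have [g [[mg hg] _ _] [gf gx]] := exists_frame dab.
have mD : measurable [set v : RR * RR | v.1 ^+ 2 + v.2 ^+ 2 < r ^+ 2] by mset.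
rewrite -(leb3_cylinder mD (area_open_disk r0) lohi).
set E := (X in _ = leb3 X).
have mE : measurable E by exact: measurableX.
rewrite -(hg E mE); congr (leb3 _); apply/seteqP; split => p; rewrite /E /open_tube/= gf gx in_itv/=.
  by move=> [? [-> ->]].
by move=> [? /andP[]].
Qed.

(** The tube is shortened at both ends so that near its points the neighbours
    behave like infinite tubes. *)
Definition core a b : set P3 := tube rad (2 * rad) (t - 2 * rad) a b.

Lemma core_swap a b : core b a = core a b.
Proof.
rewrite /core /tube; apply/seteqP; split => p /=; rewrite foot_swap axis_dist2_swap => -[-> [h1 h2]]; split => //; split; lra.
Qed.

Definition half_lens (a b a' b' : P3) : set P3 :=
  core a b `&` core a' b' `&` [set p | axis_dist2 a' b' p <= axis_dist2 a b p].

Lemma half_lens_swap a b a' b' : half_lens a b b' a' = half_lens a b a' b'.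
Proof.
rewrite /half_lens (core_swap a' b'); congr (_ `&` _); apply/funext => p /=.
by rewrite axis_dist2_swap.
Qed.

Lemma measurable_half_lens a b a' b' : measurable (half_lens a b a' b' : set (RR * RR * RR)).
Proof.
apply: measurableI; first by apply: measurableI; exact: measurable_tube.
by apply: measurable_set_le; exact: measurable_fun_axis_dist2.
Qed.

Definition on_axis (a b : P3) (x : R) : P3 := a + (x / t) *: (b - a).

Definition axes_far (a b a' b' : P3) : Prop := forall x y, 0 <= x <= t -> 0 <= y <= t ->
  4 <= dist2 (on_axis a b x) (on_axis a' b' y).

Lemma on_axis_swap a b x : on_axis b a x = on_axis a b (t - x).
Proof.
have tn0 : t != 0 by exact: lt0r_neq0.
rewrite /on_axis mulrBl divff// scalerBl scale1r.
have -> : a + (b - a - (x / t) *: (b - a)) = b - (x / t) *: (b - a).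
  by rewrite addrA addrCA subrr addr0.
by rewrite -scalerN opprB.
Qed.

Lemma axes_far_swap a b a' b' : axes_far a b a' b' -> axes_far a b b' a'.
Proof.
move=> H x y x01 y01; rewrite (on_axis_swap a' b'); apply: H => //.
by move: y01 => /andP[? ?]; apply/andP; split; lra.
Qed.

(** The radial projection onto the lateral surface of the tube of radius rad. *)
Definition surface_point (a b p : P3) : P3 :=
  on_axis a b (foot a b p) + (rad / Num.sqrt (axis_dist2 a b p)) *: (p - on_axis a b (foot a b p)).

(** The region of the tube that faces the segment a' b'. *)
Definition touches (a b a' b' p : P3) : Prop :=
  [/\ 0 < axis_dist2 a b p, axis_dist2 a b p <= rad ^+ 2, 0 <= foot a b p <= t &
     exists2 y, 0 <= y <= t & dist2 (surface_point a b p) (on_axis a' b' y) < rad ^+ 2].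

Lemma touches_swap a b a' b' p : touches a b b' a' p -> touches a b a' b' p.
Proof.
move=> [h1 h2 h3 [y /andP[y0 y1] hy]]; split => //; exists (t - y).
  by apply/andP; split; lra.
by rewrite -on_axis_swap.
Qed.

Lemma half_lens_le_acute a b a' b' : dist2 a b = t ^+ 2 -> dist2 a' b' = t ^+ 2 ->
  dist2 a a' + dist2 b b' <= dist2 a b' + dist2 b a' -> axes_far a b a' b' ->
  exists W : set (RR * RR * RR), [/\ measurable W, W `<=` touches a b a' b' &
    (leb3 (half_lens a b a' b') <= kap%:E * leb3 W)%E].
Proof.
move=> dab dab' acute sep.
have tn0 : t != 0 by exact: lt0r_neq0.
have [g rg [al [al' [S [C [h [SC C0 ga gb [ga' gb']]]]]]]] := exists_pair_frame t0 dab dab' acute.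
have [[mg hg] dg ag] := rg.
have fE p : foot a b p = (g p).2 - al by rewrite -(foot_rigid a b p rg) ga gb foot_axis.
have xE p : axis_dist2 a b p = (g p).1.1 ^+ 2 + (g p).1.2 ^+ 2.
  by rewrite -(axis_dist2_rigid a b p rg) ga gb axis_dist2_axis.
have fE' p : foot a' b' p = (g p).1.1 * S + (g p).2 * C - al'.
  by rewrite -(foot_rigid a' b' p rg) ga' gb' foot_oblique.
have xE' p : axis_dist2 a' b' p = ((g p).1.2 - h) ^+ 2 + ((g p).1.1 * C - (g p).2 * S) ^+ 2.
  by rewrite -(axis_dist2_rigid a' b' p rg) ga' gb' axis_dist2_oblique.
have gx x : g (on_axis a b x) = (0, 0, al + x).
  rewrite /on_axis ag ga gb.
  by congr (_, _, _); rewrite /= /GRing.scale/=; field.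
have gx' x : g (on_axis a' b' x) = ((al' + x) * S, h, (al' + x) * C).
  rewrite /on_axis ag ga' gb'.
  by congr (_, _, _); rewrite /= /GRing.scale/=; field.
have fsep x y : al <= x <= al + t -> al' <= y <= al' + t ->
    4 <= (y * S) ^+ 2 + h ^+ 2 + (x - y * C) ^+ 2.
  move=> /andP[x1 x2] /andP[y1 y2].
  have -> : (y * S) ^+ 2 + h ^+ 2 + (x - y * C) ^+ 2 =
      dist2 (on_axis a b (x - al)) (on_axis a' b' (y - al')).
    by rewrite -dg gx gx' /dist2/= !subrKC; ring.
  by apply: sep; apply/andP; split; lra.
pose W0 := @frame_sector R al (al + t) al' (al' + t) S C h.
have mW0 : measurable W0 by exact: measurable_frame_sector.
exists (g @^-1` W0); split.
- by rewrite -[X in measurable X]setTI; exact: mg.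
- move=> p; rewrite /= /W0; case gp : (g p) => [[v1 v2] l] Wp.
  have [n0 nr /andP[l1 l2] [y /andP[y1 y2] hy]] := frame_sector_spec SC C0 Wp.
  set n := Num.sqrt _ in n0 nr hy.
  have n2 : n ^+ 2 = v1 ^+ 2 + v2 ^+ 2 by rewrite sqr_sqrtr// addr_ge0 ?sqr_ge0.
  rewrite /touches fE xE gp /= -n2; split.
  + by rewrite exprn_gt0.
  + by rewrite ler_sqr ?nnegrE ?(ltW n0)// (le_trans (ltW n0)).
  + by apply/andP; split; lra.
  exists (y - al'); first by apply/andP; split; lra.
  rewrite -dg gx' /surface_point xE fE gp /= -/n ag gx gp.
  rewrite /dist2/= !subrKC /GRing.scale/= !subr0 !add0r subrr mulr0 addr0.
  move: hy; congr (_ < _); congr (_ ^+ 2 + _ ^+ 2 + _); congr (_ - _); exact: mulrAC.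
rewrite hg//.
have mc := @measurable_frame_half_lens R al (al + t) al' (al' + t) S C h.
apply: (le_trans _ (frame_half_lens_le SC C0 fsep)).
rewrite -(hg _ mc); apply: (@le_measure _ _ _ (@leb3 R)); rewrite ?inE.
- exact: measurable_half_lens.
- by rewrite -[X in measurable X]setTI; exact: mg.
move=> p; rewrite /half_lens /core /tube /= !fE !xE !xE' !fE'.
move=> [[[h1 [h2 h3]] [h4 [h5 h6]]] h7].
by rewrite /frame_half_lens/=; split; [split|split; split] => //; lra.
Qed.

(** The heart of the proof: the volume lost to a neighbour is at most a fixed
    proportion of the region facing that neighbour. *)
Lemma half_lens_le a b a' b' : dist2 a b = t ^+ 2 -> dist2 a' b' = t ^+ 2 ->
  axes_far a b a' b' ->
  exists W : set (RR * RR * RR), [/\ measurable W, W `<=` touches a b a' b' &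
    (leb3 (half_lens a b a' b') <= kap%:E * leb3 W)%E].
Proof.
move=> dab dab' sep.
(* The scalar product of the two directions is half the difference of the two
   sides; exchanging the ends of the second axis changes its sign. *)
have [|obtuse] := leP (dist2 a a' + dist2 b b') (dist2 a b' + dist2 b a').
  by move=> H; exact: half_lens_le_acute.
have dba' : dist2 b' a' = t ^+ 2 by rewrite -dab' /dist2; ring.
have [W [mW Wt Wl]] := half_lens_le_acute dab dba' (ltW obtuse) (axes_far_swap sep).
exists W; split => //; last by rewrite -half_lens_swap.
by move=> p /Wt /touches_swap.
Qed.
End tubes.

(** * Cells of a finite family of axes *)

Definition set_size {I : choiceType} (D : set I) : nat :=
  size (finmap.enum_fset (fset_set D)).

Section family.
Context {R : realType}.
Local Notation RR := (measurableTypeR R).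
Local Notation P3 := (R * R * R)%type.
Local Notation rad := (@circ_rad R).
Local Notation kap := (@lens_ratio R).

Lemma dist2C (p q : P3) : dist2 p q = dist2 q p.
Proof. by rewrite /dist2; ring. Qed.

Lemma dist2_midpoint (p q r : P3) : dist2 p q <= 2 * (dist2 r p + dist2 r q).
Proof.
rewrite /dist2 -subr_ge0.
have := sqr_ge0 (p.1.1 + q.1.1 - 2 * r.1.1).
have := sqr_ge0 (p.1.2 + q.1.2 - 2 * r.1.2).
have := sqr_ge0 (p.2 + q.2 - 2 * r.2).
lra.
Qed.

(** Leibniz: the sum of the squared mutual distances is three times the sum of the
    squared distances to the centroid, the point that minimizes the latter sum. *)
Lemma dist2_three (p q r s : P3) :
  dist2 p q + dist2 q r + dist2 p r <= 3 * (dist2 s p + dist2 s q + dist2 s r).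
Proof.
rewrite /dist2 -subr_ge0.
have := sqr_ge0 (p.1.1 + q.1.1 + r.1.1 - 3 * s.1.1).
have := sqr_ge0 (p.1.2 + q.1.2 + r.1.2 - 3 * s.1.2).
have := sqr_ge0 (p.2 + q.2 + r.2 - 3 * s.2).
lra.
Qed.

Variable t : R.
Hypothesis t0 : 0 < t.

Lemma dist2_on_axis (a b p : P3) (y : R) : dist2 a b = t ^+ 2 ->
  dist2 p (on_axis t a b y) = axis_dist2 t a b p + (foot t a b p - y) ^+ 2.
Proof.
move=> dab; have tn0 : t != 0 by exact: lt0r_neq0.
have [g rg [ga gb]] := exists_axis_frame (ltW t0) dab.
have [_ dg ag] := rg.
have fE : foot t a b p = (g p).2.
  have := foot_axis t0 0 (g p).
  by rewrite add0r subr0 -(foot_rigid t a b p rg) ga gb.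
have xE : axis_dist2 t a b p = (g p).1.1 ^+ 2 + (g p).1.2 ^+ 2.
  have := axis_dist2_axis t0 0 (g p).
  by rewrite add0r -(axis_dist2_rigid t a b p rg) ga gb.
rewrite -dg /on_axis ag ga gb xE fE /dist2/= /GRing.scale/=.
by field.
Qed.

Lemma dist2_foot (a b p : P3) : dist2 a b = t ^+ 2 ->
  dist2 p (on_axis t a b (foot t a b p)) = axis_dist2 t a b p.
Proof. by move=> dab; rewrite dist2_on_axis// subrr expr0n addr0. Qed.

Lemma dist2_surface (a b p : P3) : dist2 a b = t ^+ 2 -> 0 < axis_dist2 t a b p ->
  dist2 (surface_point t a b p) (on_axis t a b (foot t a b p)) = rad ^+ 2.
Proof.
move=> dab x0; have n0 : 0 < Num.sqrt (axis_dist2 t a b p) by rewrite sqrtr_gt0.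
have H := dist2_foot p dab.
have scale (x : P3) (k : R) : dist2 (x + k *: (p - x)) x = k ^+ 2 * dist2 p x.
  by case: x => [[x1 x2] x3]; rewrite /dist2/= /GRing.scale/=; ring.
rewrite /surface_point scale H (expr_div_n rad) sqr_sqrtr ?(ltW x0)//.
by rewrite divfK// gt_eqF.
Qed.

(** The surface point is at distance rad from its own axis and at distance less
    than rad from the other two, which contradicts dist2_three. *)
Lemma touches_unique (a b a1 b1 a2 b2 p : P3) : dist2 a b = t ^+ 2 ->
  axes_far t a b a1 b1 -> axes_far t a b a2 b2 -> axes_far t a1 b1 a2 b2 ->
  touches t a b a1 b1 p -> touches t a b a2 b2 p -> False.
Proof.
move=> dab s1 s2 s12 [x0 _ f01 [y y01 hy]] [_ _ _ [z z01 hz]].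
have := dist2_three (on_axis t a b (foot t a b p)) (on_axis t a1 b1 y)
   (on_axis t a2 b2 z) (surface_point t a b p).
rewrite dist2_surface//.
have := s1 _ _ f01 y01; have := s2 _ _ f01 z01; have := s12 _ _ y01 z01.
have := @rad_sqr R.
move: hy hz.
set d1 := dist2 (surface_point _ _ _ _) _; set d2 := dist2 (surface_point _ _ _ _) _.
set d3 := dist2 _ _; set d4 := dist2 _ _; set d5 := dist2 _ _.
move: (rad ^+ 2) => r2; lra.
Qed.

Variables (I : choiceType) (D : set I) (a b : I -> P3).
Hypothesis finD : finite_set D.
Hypothesis axis_length : forall i, D i -> dist2 (a i) (b i) = t ^+ 2.
Hypothesis axis_far : forall i j, D i -> D j -> i <> j -> axes_far t (a i) (b i) (a j) (b j).

Lemma fsum_const (c : R) : (\sum_(i \in D) c%:E = ((set_size D)%:R * c)%:E)%E.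
Proof.
rewrite fsbig_finite//= sumEFin /set_size; congr (_%:E).
by rewrite big_const_seq count_predT iter_addr_0 mulr_natl.
Qed.

Lemma disjoint_count (B : set (RR * RR * RR)) (F : I -> set (RR * RR * RR)) (c : R) :
  measurable B -> (forall i, D i -> measurable (F i)) -> trivIset D F ->
  (forall i, D i -> F i `<=` B) -> (forall i, D i -> (c%:E <= leb3 (F i))%E) ->
  (((set_size D)%:R * c)%:E <= leb3 B)%E.
Proof.
move=> mB mF tF FB Fc.
rewrite -fsum_const; apply: (@le_trans _ _ (\sum_(i \in D) leb3 (F i))%E).
  by apply: lee_fsum.
rewrite -(measure_fin_bigcup (@leb3 R))//.
apply: (@le_measure _ _ _ (@leb3 R)); rewrite ?inE//.
  exact: fin_bigcup_measurable.
by move=> p [i Di]; exact: FB.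
Qed.

Let lens i j := half_lens t (a i) (b i) (a j) (b j).

(** Points common to two cores are left to the nearer axis. *)
Definition cell i : set (RR * RR * RR) :=
  core t (a i) (b i) `\` \bigcup_(j in D `\ i) lens i j.

Let finDi i : finite_set (D `\ i).
Proof. exact: finite_setD. Qed.

Let measurable_lenses i : measurable (\bigcup_(j in D `\ i) lens i j : set (RR * RR * RR)).
Proof. by apply: fin_bigcup_measurable => // j _; exact: measurable_half_lens. Qed.

Lemma measurable_cell i : measurable (cell i).
Proof. by apply: measurableD => //; exact: measurable_tube. Qed.

Lemma trivIset_cell : trivIset D cell.
Proof.
move=> i j Di Dj [p [[ci ni] [cj nj]]]; apply: contrapT => ij.
have [le|lt] := leP (axis_dist2 t (a j) (b j) p) (axis_dist2 t (a i) (b i) p).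
  by apply: ni; exists j => //; split => //; exact/nesym.
apply: nj; exists i; first by [].
by split => //; exact: ltW.
Qed.

(** The regions facing the various neighbours are disjoint parts of the whole tube
    of length t, so the losses add up to at most lens_ratio times its volume. *)
Lemma cell_volume i : 4 * rad <= t -> D i ->
  ((pi * rad ^+ 2 * (t - 4 * rad) - kap * (pi * rad ^+ 2 * t))%:E <= leb3 (cell i))%E.
Proof.
move=> rt Di.
have r0 := @rad_gt0 R.
have [W HW] : exists W : I -> set (RR * RR * RR), forall j, (D `\ i) j ->
    [/\ measurable (W j), W j `<=` touches t (a i) (b i) (a j) (b j) &
       (leb3 (lens i j) <= kap%:E * leb3 (W j))%E].
  suff : forall j, exists W : set (RR * RR * RR), (D `\ i) j ->
    [/\ measurable W, W `<=` touches t (a i) (b i) (a j) (b j) &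
       (leb3 (lens i j) <= kap%:E * leb3 W)%E] by move=> /choice[W HW]; exists W.
  move=> j; have [[Dj ji]|nj] := pselect ((D `\ i) j); last by exists set0.
  have [W ?] := half_lens_le t0 (axis_length Di) (axis_length Dj)
    (axis_far Di Dj (nesym ji)).
  by exists W.
have mcore : measurable (core t (a i) (b i) : set (RR * RR * RR)) by exact: measurable_tube.
have coreE : leb3 (core t (a i) (b i)) = (pi * rad ^+ 2 * (t - 4 * rad))%:E.
  rewrite /core leb3_tube ?axis_length ?(ltW r0)//; last lra.
  by congr (_%:E); congr (_ * _); ring.
have Wtube : (\sum_(j \in D `\ i) leb3 (W j) <= (pi * rad ^+ 2 * t)%:E)%E.
  rewrite -(measure_fin_bigcup (@leb3 R))//; last 2 first.
  - move=> j k Dj Dk [p [Wj Wk]]; apply: contrapT => jk.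
    have [_ /(_ _ Wj) tj _] := HW _ Dj; have [_ /(_ _ Wk) tk _] := HW _ Dk.
    have [Dj' /nesym ij] := Dj; have [Dk' /nesym ik] := Dk.
    exact: (touches_unique (axis_length Di) (axis_far Di Dj' ij)
       (axis_far Di Dk' ik) (axis_far Dj' Dk' jk) tj tk).
  - by move=> j /HW[].
  have -> : pi * rad ^+ 2 * t = pi * rad ^+ 2 * (t - 0) by rewrite subr0.
  rewrite -(leb3_tube t0 (axis_length Di) (ltW r0) (ltW t0)).
  apply: (@le_measure _ _ _ (@leb3 R)); rewrite ?inE.
  - by apply: fin_bigcup_measurable => // j /HW[].
  - exact: measurable_tube.
  by move=> p [j /HW[_ Wt _] /Wt[_ H1 /andP[H2 H3] _]].
have lens_sum : (\sum_(j \in D `\ i) leb3 (lens i j) <= (kap * (pi * rad ^+ 2 * t))%:E)%E.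
  apply: (@le_trans _ _ (\sum_(j \in D `\ i) kap%:E * leb3 (W j))%E).
    by apply: lee_fsum => // j /HW[].
  rewrite -ge0_mule_fsumr//.
  by rewrite EFinM lee_wpmul2l// lee_fin lens_ratio_ge0.
have : (leb3 (core t (a i) (b i)) <= leb3 (cell i) + (kap * (pi * rad ^+ 2 * t))%:E)%E.
  apply: (@le_trans _ _ (leb3 (cell i) + \sum_(j \in D `\ i) leb3 (lens i j))%E); last exact: leeD2l.
  apply: (@le_trans _ _ (leb3 (cell i `|` \bigcup_(j in D `\ i) lens i j))).
    apply: (@le_measure _ _ _ (@leb3 R)); rewrite ?inE//.
      by apply: measurableU => //; exact: measurable_cell.
    by move=> p cp; have [|] := pselect ((\bigcup_(j in D `\ i) lens i j) p); [right|left].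
  apply: (le_trans (measureU2 (@leb3 R) (measurable_cell i) (measurable_lenses i))).
  apply: leeD2l; apply: content_sub_fsum => // j _.
  exact: measurable_half_lens.
by rewrite coreE EFinB leeBlDr.
Qed.

Lemma count_cells (B : set (RR * RR * RR)) : 4 * rad <= t -> measurable B ->
  (forall i p, D i -> core t (a i) (b i) p -> B p) ->
  (((set_size D)%:R * (pi * rad ^+ 2 * (t - 4 * rad) - kap * (pi * rad ^+ 2 * t)))%:E
    <= leb3 B)%E.
Proof.
move=> rt mB coreB; apply: (@disjoint_count _ cell) => //.
- by move=> i _; exact: measurable_cell.
- exact: trivIset_cell.
- by move=> i Di p [cp _]; exact: coreB cp.
- by move=> i Di; exact: cell_volume.
Qed.

Lemma count_unit_tubes (B : set (RR * RR * RR)) : measurable B ->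
  (forall i p, D i -> open_tube t 1 0 t (a i) (b i) p -> B p) ->
  (((set_size D)%:R * (pi * t))%:E <= leb3 B)%E.
Proof.
move=> mB tubeB.
apply: (@disjoint_count _ (fun i => open_tube t 1 0 t (a i) (b i))) => //.
- by move=> i _; exact: measurable_open_tube.
- move=> i j Di Dj [p [[x1 [f1 f1']] [x2 [f2 f2']]]]; apply: contrapT => ij.
  have f1b : 0 <= foot t (a i) (b i) p <= t by rewrite f1.
  have f2b : 0 <= foot t (a j) (b j) p <= t by rewrite f2.
  have := axis_far Di Dj ij f1b f2b.
  have := dist2_midpoint (on_axis t (a i) (b i) (foot t (a i) (b i) p))
    (on_axis t (a j) (b j) (foot t (a j) (b j) p)) p.
  rewrite !dist2_foot ?axis_length//.
  move: x1 x2; rewrite expr1n; set x := axis_dist2 _ _ _ _; set y := axis_dist2 _ _ _ _.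
  set z := dist2 _ _; lra.
- by move=> i Di p; exact: tubeB.
- by move=> i Di; rewrite leb3_open_tube ?axis_length ?(ltW t0)// expr1n mulr1 subr0.
Qed.
End family.

(** * Capped cylinders and balls *)

Section packing_geometry.
Context {R : realType}.
Local Notation RR := (measurableTypeR R).
Local Notation mu := (@lebesgue_measure R).
Local Notation P3 := (R * R * R)%type.
Local Notation rad := (@circ_rad R).

Lemma enormB (p q : P3) : enorm (p - q) = Num.sqrt (dist2 p q).
Proof. by []. Qed.

Lemma dist2_ge0 (p q : P3) : 0 <= dist2 p q.
Proof. by rewrite /dist2 !addr_ge0 ?sqr_ge0. Qed.

(** Lagrange's identity gives the Cauchy-Schwarz inequality. *)
Lemma edist_triangle (p q r : P3) :
  Num.sqrt (dist2 p r) <= Num.sqrt (dist2 p q) + Num.sqrt (dist2 q r).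
Proof.
have A0 := dist2_ge0 p q; have B0 := dist2_ge0 q r.
set sA := Num.sqrt (dist2 p q); set sB := Num.sqrt (dist2 q r).
have sA2 : sA ^+ 2 = dist2 p q by rewrite sqr_sqrtr.
have sB2 : sB ^+ 2 = dist2 q r by rewrite sqr_sqrtr.
have sAB : 0 <= sA + sB by rewrite addr_ge0 ?sqrtr_ge0.
rewrite -(ger0_norm sAB) -sqrtr_sqr ler_sqrt ?sqr_ge0//.
pose u1 := p.1.1 - q.1.1; pose u2 := p.1.2 - q.1.2; pose u3 := p.2 - q.2.
pose v1 := q.1.1 - r.1.1; pose v2 := q.1.2 - r.1.2; pose v3 := q.2 - r.2.
have dot : u1 * v1 + u2 * v2 + u3 * v3 <= sA * sB.
  rewrite (le_trans (ler_norm _))//.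
  have : (u1 * v1 + u2 * v2 + u3 * v3) ^+ 2 <= (sA * sB) ^+ 2.
    rewrite exprMn sA2 sB2 /dist2 -/u1 -/u2 -/u3 -/v1 -/v2 -/v3 -subr_ge0.
    rewrite (_ : _ - _ = (u1 * v2 - u2 * v1) ^+ 2 + (u2 * v3 - u3 * v2) ^+ 2 + (u1 * v3 - u3 * v1) ^+ 2); last by ring.
    by rewrite !addr_ge0 ?sqr_ge0.
  by rewrite -(real_normK (num_real (_ + _))) ler_sqr ?nnegrE ?mulr_ge0 ?sqrtr_ge0.
rewrite sqrrD sA2 sB2.
have -> : dist2 p r = dist2 p q + dist2 q r + 2 * (u1 * v1 + u2 * v2 + u3 * v3).
  by rewrite /dist2 /u1 /u2 /u3 /v1 /v2 /v3; ring.
lra.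
Qed.

Lemma nbhs_edist (q m : P3) (A : set P3) : dist2 m q < 1 ->
  (forall p, dist2 p q < 1 -> A p) -> nbhs m A.
Proof.
move=> mq HA.
set d := Num.sqrt (dist2 m q).
have d1 : d < 1 by rewrite -sqrtr1 ltr_sqrt.
apply/nbhs_ballP; exists ((1 - d) / 3) => /=; first by rewrite divr_gt0 ?subr_gt0.
move=> p [[/= h1 h2] h3]; apply: HA.
rewrite /ball/= in h1 h2 h3.
set e := (1 - d) / 3 in h1 h2 h3.
have H (x y : R) : `|x - y| < e -> (x - y) ^+ 2 <= e ^+ 2.
  move=> xy; have e0 : 0 < e by exact: le_lt_trans xy.
  by rewrite -(real_normK (num_real (x - y))) ler_sqr ?nnegrE ?(ltW e0)// ltW.
have e0 : 0 < e by rewrite divr_gt0 ?subr_gt0.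
have pm : Num.sqrt (dist2 m p) < 3 * e.
  have e3 : 0 <= 3 * e by rewrite mulr_ge0// ltW.
  rewrite -(ger0_norm e3) -sqrtr_sqr ltr_sqrt; last by rewrite exprn_gt0// mulr_gt0.
  rewrite /dist2; have := H _ _ h1; have := H _ _ h2; have := H _ _ h3.
  have : 0 < e ^+ 2 by rewrite exprn_gt0.
  rewrite (exprMn 2 3 e); lra.
have : Num.sqrt (dist2 p q) < 1.
  apply: (le_lt_trans (edist_triangle p m q)); rewrite dist2C -/d.
  by move: pm; rewrite /e; lra.
by rewrite -[ltRHS]sqrtr1 ltr_sqrt.
Qed.

Lemma measurable_eball (r : R) : measurable (eball r : set (RR * RR * RR)).
Proof.
apply: measurable_set_le; last exact: measurable_cst.
by apply: measurable_fun_sqrtr; mfun.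
Qed.

Lemma enorm_le (p : P3) (r : R) : 0 <= r ->
  (enorm p <= r) = (p.1.1 ^+ 2 + p.1.2 ^+ 2 + p.2 ^+ 2 <= r ^+ 2).
Proof.
by move=> r0; rewrite /enorm -[in LHS](ger0_norm r0) -sqrtr_sqr ler_sqrt ?sqr_ge0.
Qed.

Lemma volume_eball (r : R) : 0 <= r -> volume (eball r) = (4 / 3 * pi * r ^+ 3)%:E.
Proof.
move=> r0; rewrite volumeE /leb3 product_measure_ysection; last exact: measurable_eball.
transitivity (\int[mu]_(x in `[(- r)%R, r]) (pi * (r ^+ 2 - x ^+ 2))%R%:E)%E.
  rewrite [RHS]integral_mkcond; apply: eq_integral => x _.
  rewrite patchE mem_setE in_itv/=.
  case: ifPn => [/andP[x1 x2]|xr].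
    have a0 : 0 <= r ^+ 2 - x ^+ 2 by nra.
    rewrite -[in RHS](sqr_sqrtr a0) -area_closed_disk ?sqrtr_ge0//.
    congr (leb2 _); apply/funext => v; rewrite /ysection/= in_setE/=.
    by rewrite /eball/= enorm_le//= sqr_sqrtr// lerBrDr.
  rewrite (_ : ysection _ _ = set0) ?measure0//.
  rewrite -subset0 => v; rewrite /ysection/= in_setE /eball/= enorm_le//= => H.
  move/negP: xr; apply.
  have := sqr_ge0 v.1; have := sqr_ge0 v.2 => v2 v1.
  have x2 : (x : R) ^+ 2 <= r ^+ 2 by apply: le_trans H; rewrite lerDr addr_ge0.
  by rewrite -ler_norml -ler_sqr ?nnegrE// real_normK ?num_real.
have dF (x : R) : is_derive x (1 : R) (fun x : R => pi * r ^+ 2 * x - pi / 3 * x ^+ 3)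
    (pi * (r ^+ 2 - x ^+ 2)).
  have H := is_deriveB (is_deriveZ (pi * r ^+ 2) (is_derive_id x (1 : R)))
    (is_deriveZ (pi / 3) (is_deriveX 3 (is_derive_id x (1 : R)))).
  apply: (is_derive_eq H); rewrite /GRing.scale/=.
  by move: (pi : R) => p; field.
rewrite (integral_derive _ dF).
- by congr (_%:E); move: (pi : R) => p; field.
- lra.
move=> x; apply: cvgM; first exact: cvg_cst.
by apply: cvgB; [exact: cvg_cst|exact: exprn_continuous].
Qed.

Variable t : R.
Hypothesis t0 : 0 < t.

Lemma axis_dist2_ge0 (a b p : P3) : dist2 a b = t ^+ 2 -> 0 <= axis_dist2 t a b p.
Proof. by move=> dab; rewrite -(dist2_foot t0 p dab) dist2_ge0. Qed.

Definition clamp (x : R) : R := Num.min (Num.max x 0) t.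

Lemma clamp_in x : 0 <= clamp x <= t.
Proof.
rewrite /clamp ge_min lexx orbT andbT le_min (ltW t0) andbT.
by rewrite le_max lexx orbT.
Qed.

Lemma clamp_closest x y : 0 <= y <= t -> (x - clamp x) ^+ 2 <= (x - y) ^+ 2.
Proof.
move=> /andP[y0 yt]; rewrite /clamp.
have := t0 => t0'; case: (leP x 0) => x0; case: (leP _ t) => xt.
- by nra.
- by nra.
- by rewrite subrr expr0n/= sqr_ge0.
- by nra.
Qed.

(** The infimum is attained at the foot of the perpendicular, moved to the nearer
    end if it falls outside the segment. *)
Lemma edist_to_segment (a b p : P3) : dist2 a b = t ^+ 2 ->
  edist_to (segment a b) p =
  Num.sqrt (axis_dist2 t a b p + (foot t a b p - clamp (foot t a b p)) ^+ 2).
Proof.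
move=> dab; have tn0 : t != 0 by exact: lt0r_neq0.
have /andP[c0 c1] := clamp_in (foot t a b p).
rewrite -(dist2_on_axis t0 p (clamp (foot t a b p)) dab).
apply/eqP; rewrite eq_le; apply/andP; split.
  apply: ge_inf.
    by exists 0 => _ [q _ <-]; exact: sqrtr_ge0.
  exists (on_axis t a b (clamp (foot t a b p))); last by rewrite enormB.
  exists (clamp (foot t a b p) / t) => //=.
  by rewrite in_itv/= divr_ge0 ?(ltW t0)//= ler_pdivrMr// mul1r.
apply: lb_le_inf.
  by exists (enorm (p - (a + 0 *: (b - a)))), (a + 0 *: (b - a)) => //; exists 0 => //=; rewrite in_itv/= lexx ler01.
move=> _ [_ [s s01 <-] <-]; rewrite enormB.
have -> : a + s *: (b - a) = on_axis t a b (s * t) by rewrite /on_axis mulfK.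
rewrite ler_sqrt ?dist2_ge0// !(dist2_on_axis t0 _ _ dab) lerD2l.
apply: clamp_closest; move: s01; rewrite /= in_itv/= => /andP[s0 s1].
by rewrite mulr_ge0 ?(ltW t0)//= -[leRHS]mul1r ler_pM2r.
Qed.

Definition capped (a b : P3) : set P3 := [set p | edist_to (segment a b) p <= 1].

Lemma cappedP (a b p : P3) : dist2 a b = t ^+ 2 ->
  capped a b p <-> axis_dist2 t a b p + (foot t a b p - clamp (foot t a b p)) ^+ 2 <= 1.
Proof.
move=> dab; rewrite /capped/= edist_to_segment// -[X in _ <= X]sqrtr1.
by rewrite ler_sqrt.
Qed.

Lemma measurable_capped (a b : P3) : dist2 a b = t ^+ 2 ->
  measurable (capped a b : set (RR * RR * RR)).
Proof.
move=> dab.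
have -> : capped a b = [set p | axis_dist2 t a b p + (foot t a b p - clamp (foot t a b p)) ^+ 2 <= 1].
  by apply/seteqP; split => p /= /cappedP; apply.
apply: measurable_set_le; last exact: measurable_cst.
apply: measurable_funD; first exact: measurable_fun_axis_dist2.
apply: measurable_funX; apply: measurable_funB; first exact: measurable_fun_foot.
apply: measurable_minr; last exact: measurable_cst.
apply: measurable_maxr; last exact: measurable_cst.
exact: measurable_fun_foot.
Qed.

(** The unit tube lengthened by 1 at both ends contains the body; this upper bound
    is precise enough. *)
Lemma volume_capped (a b : P3) : dist2 a b = t ^+ 2 ->
  (volume (capped a b) <= (pi * (t + 2))%:E)%E.
Proof.
move=> dab; rewrite volumeE; have t0' := t0.
have -> : pi * (t + 2) = pi * 1 ^+ 2 * (t + 1 - (-1)) by rewrite expr1n mulr1; congr (_ * _); ring.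
rewrite -(leb3_tube t0 dab)//; last lra.
apply: (@le_measure _ _ _ (@leb3 R)); rewrite ?inE.
- exact: measurable_capped.
- exact: measurable_tube.
move=> p /(cappedP p dab) H; rewrite /tube/= expr1n.
have x0 := axis_dist2_ge0 p dab.
have s0 := sqr_ge0 (foot t a b p - clamp (foot t a b p)).
split; first lra.
have : `|foot t a b p - clamp (foot t a b p)| <= 1.
  by rewrite -ler_sqr ?nnegrE// real_normK ?num_real// expr1n; lra.
have := clamp_in (foot t a b p); rewrite ler_norml => /andP[? ?] /andP[? ?].
by split; lra.
Qed.

Lemma near_axis_capped (a b p : P3) (y : R) : dist2 a b = t ^+ 2 -> 0 <= y <= t ->
  dist2 p (on_axis t a b y) <= 1 -> capped a b p.
Proof.
move=> dab y01 H; apply/(cappedP p dab).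
move: H; rewrite (dist2_on_axis t0 _ _ dab); apply: le_trans.
by rewrite lerD2l; exact: clamp_closest.
Qed.

Lemma disjoint_interior_far (a b a' b' : P3) : dist2 a b = t ^+ 2 -> dist2 a' b' = t ^+ 2 ->
  interior (capped a b) `&` interior (capped a' b') = set0 -> axes_far t a b a' b'.
Proof.
move=> dab dab' disj x y x01 y01; rewrite leNgt; apply/negP.
set p := on_axis t a b x; set q := on_axis t a' b' y => pq.
(* The midpoint of two axis points closer than 2 is interior to both bodies. *)
pose m : P3 := ((p.1.1 + q.1.1) / 2, (p.1.2 + q.1.2) / 2, (p.2 + q.2) / 2).
have mp : dist2 m p < 1.
  rewrite (_ : dist2 m p = dist2 p q / 4); last by rewrite /dist2 /m/=; field.
  lra.
have mq : dist2 m q < 1.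
  rewrite (_ : dist2 m q = dist2 p q / 4); last by rewrite /dist2 /m/=; field.
  lra.
suff : (interior (capped a b) `&` interior (capped a' b')) m by rewrite disj.
split; rewrite /interior/=.
  apply: (nbhs_edist mp) => z zp; apply: (near_axis_capped dab x01); exact: ltW.
apply: (nbhs_edist mq) => z zp; apply: (near_axis_capped dab' y01); exact: ltW.
Qed.

Lemma open_tube_capped (a b p : P3) : dist2 a b = t ^+ 2 ->
  open_tube t 1 0 t a b p -> capped a b p.
Proof.
move=> dab [x1 [f0 f1]]; apply: (@near_axis_capped _ _ _ (foot t a b p) dab).
  by rewrite f0.
by rewrite dist2_foot// ltW// -(expr1n _ 2).
Qed.

Lemma core_in_ball (a b p : P3) (r : R) : dist2 a b = t ^+ 2 ->
  capped a b `<=` eball r -> core t a b p -> eball (r + rad) p.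
Proof.
move=> dab sub [x1 [f0 f1]].
have r0 := @rad_gt0 R.
have f01 : 0 <= foot t a b p <= t by apply/andP; split; lra.
set x := on_axis t a b (foot t a b p).
have xr : enorm x <= r.
  apply: sub; apply: (near_axis_capped dab f01).
  by rewrite /x /dist2 !subrr expr0n/= !addr0.
have px : Num.sqrt (dist2 p x) <= rad.
  rewrite /x dist2_foot// -(ger0_norm (ltW r0)) -sqrtr_sqr ler_sqrt// sqr_ge0//.
have := edist_triangle p x 0; rewrite -!enormB !subr0 => H.
rewrite /eball/=; apply: (le_trans H); rewrite addrC lerD//.
Qed.
End packing_geometry.

(** * Density *)

Section density.
Context {R : realType}.
Local Notation RR := (measurableTypeR R).
Local Notation P3 := (R * R * R)%type.
Local Notation rad := (@circ_rad R).
Local Notation kap := (@lens_ratio R).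
Local Notation q := (Num.sqrt (3 : R)).

Lemma sqrt12E : Num.sqrt 12 = 2 * q :> R.
Proof.
rewrite (_ : 12 = 2 ^+ 2 * 3); last by ring.
by rewrite sqrtrM ?sqr_ge0// sqrtr_sqr ger0_norm.
Qed.

(** Equivalent to 1 <= pi / sqrt 12 + 8 / t; for t = 40 this still follows from
    pi >= 3. *)
Lemma small_density (t : R) : 0 < t -> t <= 40 ->
  (t + 2) / t <= pi / Num.sqrt 12 + 10 / t.
Proof.
move=> t0 t40; rewrite sqrt12E.
have p3 := @pi_ge3 R; have q0 := @sqrt3_gt0 R; have q2 := @sqrt3_sqr R.
have q1 : q <= 7 / 4 by nra.
have h1 : 8 / 10 <= pi / (2 * q) by rewrite ler_pdivlMr ?mulr_gt0//; lra.
have h2 : 2 / 10 <= 8 / t by rewrite ler_pdivlMr//; lra.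
have -> : (t + 2) / t = 1 + 2 / t by field; exact: lt0r_neq0.
have -> : 10 / t = 2 / t + 8 / t by field; exact: lt0r_neq0.
lra.
Qed.

Definition cell_bound (t : R) : R :=
  pi * rad ^+ 2 * (t - 4 * rad) - kap * (pi * rad ^+ 2 * t).

(** The leading coefficient is sqrt 12, the area of the hexagon circumscribed about
    the unit disc. *)
Lemma cell_boundE (t : R) : cell_bound t = 2 * q * t - 32 * pi / (3 * q).
Proof.
rewrite /cell_bound rad_sqr /lens_ratio /circ_rad.
have := pi_gt0 R; move: (pi : R) => p p0.
have qn : q != 0 by exact: lt0r_neq0 sqrt3_gt0.
by field; rewrite qn lt0r_neq0.
Qed.

Lemma cell_bound_gt0 (t : R) : 40 <= t -> 0 < cell_bound t.
Proof.
move=> t40; rewrite cell_boundE.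
have p3 := @pi_le_sqrt12 R; have q0 := @sqrt3_gt0 R; have q2 := @sqrt3_sqr R.
have q1 : 1 <= q by nra.
have : 32 * pi / (3 * q) <= 64 / 3.
  by rewrite ler_pdivrMr ?mulr_gt0//; lra.
nra.
Qed.

(** With x = pi / sqrt 3 the claim becomes polynomial in x, 1 / t and sqrt 3, and
    x <= 2 and 1 / t <= 1 / 40 suffice. *)
Lemma large_density (t : R) : 40 <= t ->
  pi * (t + 2) / cell_bound t <= pi / Num.sqrt 12 + 10 / t.
Proof.
move=> t40; have c0 := cell_bound_gt0 t40.
have t0 : 0 < t by lra.
rewrite ler_pdivrMr// cell_boundE sqrt12E.
have p3 := @pi_le_sqrt12 R; have q0 := @sqrt3_gt0 R; have q2 := @sqrt3_sqr R.
have p0 := pi_gt0 R.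
have q1 : 17 / 10 <= q by nra.
set x := pi / q.
have px : pi = x * q by rewrite /x divfK// gt_eqF.
have x2 : x <= 2 by rewrite /x ler_pdivrMr.
have x0 : 0 < x by rewrite divr_gt0.
pose y := t^-1.
have y0 : 0 < y by rewrite invr_gt0.
have yt : t * y = 1 by rewrite divff// gt_eqF.
have y40 : y <= 1 / 40 by rewrite -[y]div1r ler_pdivrMr//; lra.
have -> : 32 * pi / (3 * q) = 32 / 3 * x by rewrite px; field; exact: lt0r_neq0.
have -> : pi / (2 * q) = x / 2 by rewrite px; field; exact: lt0r_neq0.
rewrite -/y px.
have -> : (x / 2 + 10 * y) * (2 * q * t - 32 / 3 * x) =
   x * q * t + 20 * q * (t * y) - 16 / 3 * x ^+ 2 - 320 / 3 * (x * y) by field.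
rewrite yt.
have xx : x ^+ 2 <= 4 by nra.
have xy : x * y <= 2 / 40 by nra.
have xq : x * q <= 2 * q by nra.
lra.
Qed.

Section one_packing.
Variables (t : R) (I : countType) (C : I -> set P3).
Hypothesis t0 : 0 < t.
Hypothesis hC : packing t C.

Lemma packing_axes : exists ab : I -> P3 * P3,
  [/\ forall i, dist2 (ab i).1 (ab i).2 = t ^+ 2,
      forall i, C i = capped (ab i).1 (ab i).2 &
      forall i j, i <> j -> axes_far t (ab i).1 (ab i).2 (ab j).1 (ab j).2].
Proof.
have [cyl triv] := hC.
have [ab Hab] : exists ab : I -> P3 * P3, forall i,
    dist2 (ab i).1 (ab i).2 = t ^+ 2 /\ C i = capped (ab i).1 (ab i).2.
  suff : forall i, exists ab : P3 * P3, dist2 ab.1 ab.2 = t ^+ 2 /\ C i = capped ab.1 ab.2.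
    by move=> /choice[ab Hab]; exists ab.
  move=> i; have [a [b [dab Cab]]] := cyl i.
  exists (a, b) => /=; split => //.
  by rewrite -dab enormB sqr_sqrtr ?dist2_ge0 1?dist2C.
exists ab; split=> [i|i|i j ij]; [by have [] := Hab i|by have [] := Hab i|].
have [di Ci] := Hab i; have [dj Cj] := Hab j.
apply: (disjoint_interior_far t0 di dj); rewrite -Ci -Cj.
move/trivIsetP : triv => /(_ i j Logic.I Logic.I); apply; exact/eqP.
Qed.

Definition density_factor : R :=
  if t <= 40 then (t + 2) / t else pi * (t + 2) / cell_bound t.

Lemma density_factor_le : density_factor <= pi / Num.sqrt 12 + 10 / t.
Proof.
rewrite /density_factor; case: ifPn => [|]; first exact: small_density.
by rewrite -ltNge => /ltW; exact: large_density.
Qed.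

Lemma density_factor_ge0 : 0 <= density_factor.
Proof.
have t0' := t0; rewrite /density_factor; case: ifPn => [_|].
  by rewrite divr_ge0//; lra.
rewrite -ltNge => /ltW t40.
by rewrite divr_ge0// ?(ltW (cell_bound_gt0 t40))// mulr_ge0 ?pi_ge0//; lra.
Qed.

(** Disjoint unit tubes lie in the ball itself, cells in the ball enlarged by rad,
    which accounts for the cubic factor. *)
Lemma finite_density_le (r : R) (D : set I) : 0 < r -> finite_set D ->
  (forall i, D i -> C i `<=` eball r) ->
  (\sum_(i \in D) (volume (C i) / volume (eball r)) <=
   (density_factor * ((r + rad) / r) ^+ 3)%:E)%E.
Proof.
move=> r0 finD Dr.
have [ab [dab Cab fab]] := packing_axes.
pose a i := (ab i).1; pose b i := (ab i).2.
have fabD i j : D i -> D j -> i <> j -> axes_far t (a i) (b i) (a j) (b j) by move=> _ _; exact: fab.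
have dabD i : D i -> dist2 (a i) (b i) = t ^+ 2 by move=> _; exact: dab.
have p0 := pi_gt0 R; have rad0 := @rad_gt0 R; have t0' := t0.
pose V : R := 4 / 3 * pi * r ^+ 3.
have V0 : 0 < V by rewrite !mulr_gt0// exprn_gt0.
pose n : R := (set_size D)%:R.
have n0 : 0 <= n by rewrite ler0n.
have each i : D i -> (volume (C i) / volume (eball r) <= (pi * (t + 2) / V)%:E)%E.
  move=> Di; rewrite volume_eball ?(ltW r0)// -/V inver gt_eqF// EFinM.
  by rewrite lee_wpmul2r ?lee_fin ?invr_ge0 ?(ltW V0)// Cab; exact: volume_capped.
have total : (\sum_(i \in D) (volume (C i) / volume (eball r)) <= (n * (pi * (t + 2) / V))%:E)%E.
  apply: (@le_trans _ _ (\sum_(i \in D) (pi * (t + 2) / V)%:E)%E).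
    by apply: lee_fsum.
  by rewrite fsum_const.
apply: (le_trans total); rewrite lee_fin /density_factor.
have ge1 : 1 <= (r + rad) / r by rewrite ler_pdivlMr//; lra.
have ge13 : 1 <= ((r + rad) / r) ^+ 3 by rewrite exprn_ege1.
case: ifPn => [t40|].
  have := count_unit_tubes t0 finD dabD fabD (measurable_eball r).
  have tubes : forall i p, D i -> open_tube t 1 0 t (a i) (b i) p -> eball r p.
    move=> i p Di op; apply: (Dr i Di); rewrite Cab.
    exact: (open_tube_capped t0 (dab i) op).
  move=> /(_ tubes); rewrite -volumeE volume_eball ?(ltW r0)// lee_fin -/V -/n => H.
  apply: (@le_trans _ _ ((t + 2) / t)).
    rewrite mulrA ler_pdivrMr// mulrAC ler_pdivlMr//.
    rewrite -[leRHS]mulrC.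
    have := ler_wpM2r (_ : 0 <= t + 2) H; rewrite -/V.
    move=> /(_ ltac:(lra)); lra.
  by rewrite ler_peMr// divr_ge0//; lra.
rewrite -ltNge => t40.
have c0 := cell_bound_gt0 (ltW t40).
have rad4 : 4 * rad <= t.
  have := @rad_sqr R; nra.
have := count_cells t0 finD dabD fabD rad4 (measurable_eball (r + rad)).
have cores : forall i p, D i -> core t (a i) (b i) p -> eball (r + rad) p.
  move=> i p Di; apply: (core_in_ball t0 (dab i)).
  by rewrite -Cab; exact: Dr.
move=> /(_ cores); rewrite -volumeE volume_eball; last lra.
rewrite lee_fin -/(cell_bound t) -/n => H.
set V' := 4 / 3 * pi * _ in H.
have -> : ((r + rad) / r) ^+ 3 = V' / V.
  rewrite /V' /V; move: (pi : R) p0 (rad) => p p0 w.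
  by field; rewrite !lt0r_neq0.
have nV : n <= V' / cell_bound t by rewrite ler_pdivlMr.
have -> : pi * (t + 2) / cell_bound t * (V' / V) = V' / cell_bound t * (pi * (t + 2) / V).
  move: (V') (V) (cell_bound t) (pi : R) => v' v c p; ring.
by apply: ler_wpM2r nV; rewrite divr_ge0 ?(ltW V0)// mulr_ge0 ?(ltW p0)//; lra.
Qed.

Lemma upper_density_le :
  (upper_density C <= density_factor%:E)%E.
Proof.
have K0 := density_factor_ge0; have rad0 := @rad_gt0 R.
apply/lee_addgt0Pr => e e0.
pose K := density_factor.
pose M := rad + 7 * K * rad / e.
have KM : 0 <= 7 * K * rad / e by rewrite divr_ge0 ?(ltW e0)// !mulr_ge0// ltW.
have M0 : 0 < M by rewrite /M ltr_pwDl.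
apply: (@le_trans _ _ (ereal_sup ((fun r : R => \esum_(i in [set i | C i `<=` eball r])
      (volume (C i) / volume (eball r))%E) @` [set r | M < r]))).
  apply: ereal_inf_lbound; exists [set r | M < r] => //.
  by exists M; split => //; exact: num_real.
apply: ge_ereal_sup => _ [r /= Mr <-].
have r0 : 0 < r by exact: lt_trans Mr.
apply: ge_ereal_sup => _ [D [finD DS] <-].
apply: (le_trans (finite_density_le r0 finD DS)).
rewrite -EFinD lee_fin -/K.
pose u := rad / r.
have u0 : 0 <= u by rewrite divr_ge0 ?ltW.
have u1 : u <= 1 by rewrite ler_pdivrMr// mul1r; move: Mr; rewrite /M; lra.
have -> : (r + rad) / r = 1 + u by rewrite mulrDl divff// gt_eqF.
(* (1 + rad / r)^3 tends to 1: quantitatively, it is at most 1 + 7 rad / r for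
   r >= rad, whence the threshold M. *)
have cube : (1 + u) ^+ 3 <= 1 + 7 * u.
  have u2 : u ^+ 2 <= u by rewrite expr2 ler_piMr.
  have u3 : u ^+ 3 <= u ^+ 2 by rewrite exprS ler_piMl ?sqr_ge0.
  have -> : (1 + u) ^+ 3 = 1 + 3 * u + 3 * u ^+ 2 + u ^+ 3 by ring.
  lra.
have Ku : 7 * K * u <= e.
  rewrite /u mulrA ler_pdivrMr// -ler_pdivrMl//.
  by rewrite mulrC; apply: ltW; apply: le_lt_trans Mr; rewrite /M lerDr ltW.
have : K * (1 + u) ^+ 3 <= K * (1 + 7 * u) by rewrite ler_wpM2l.
lra.
Qed.

End one_packing.
End density.

Unset Implicit Arguments.
Set Strict Implicit.
Set Printing Implicit Defensive.

Theorem theorem15 (R : realType) (t : R) (ht : 0 < t)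
    (I : countType) (C : I -> set (R * R * R)) (hC : packing t C) :
  (upper_density C <= (pi / Num.sqrt 12 + 10 / t)%:E)%E.
Proof.
apply: (le_trans (upper_density_le ht hC)).
by rewrite lee_fin; exact: density_factor_le.
Qed.
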